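(* Let $p$ be a prime, let $F$ be a finite field of characteristic $p$, and let $G$ be a finite abelian $p$-group. Let $H$ be a group. Then $V_*(FG)\cong V_*(FH)$ (as groups) if and only if $G\cong H$.
   Context: For a group $G$ and a field $F$, $FG$ denotes the group algebra. The augmentation of $x=\sum_{g\in G}\alpha_g g\in FG$ is $\chi(x)=\sum_{g\in G}\alpha_g$, and $V(FG)$ denotes the normalized unit group of $FG$, i.e. the group of units of $FG$ with augmentation $1$. The classical involution $*$ on $FG$ is the $F$-linear map with $g^*=g^{-1}$ for all $g\in G$, i.e. $\big(\sum_{g}\alpha_g g\big)^*=\sum_g\alpha_g g^{-1}$. An element $u\in V(FG)$ is called unitary if $u^{-1}=u^*$. The unitary subgroup $V_*(FG)$ is the subgroup of $V(FG)$ consisting of all unitary elements. *)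

(* Defs.v *)
From HB Require Import structures.
From mathcomp Require Import all_boot all_order all_fingroup all_algebra.
From mathcomp Require Import all_solvable.
From mathcomp Require Import finmap.
From mathcomp Require Import boolp.
From mathcomp.multinomials Require Import monalg.

Set Implicit Arguments.
Unset Strict Implicit.
Unset Printing Implicit Defensive.

Import GRing.Theory.
Local Open Scope fset_scope.
Local Open Scope ring_scope.

(* [{malg F[G]}] is the free F-module of finitely supported functions on G.   *)
(* Its ring structure in monalg.v requires the only invertible monomial to be *)
(* 1, which excludes groups, hence this alias carrying the convolution ring.  *)
Definition galg (F : fieldType) (G : groupType) : Type := {malg F[G]}.

HB.instance Definition _ (F : fieldType) (G : groupType) :=
  GRing.Lmodule.copy (galg F G) {malg F[G]}.

Section GroupAlgebraRing.
Context (F : fieldType) (G : groupType).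
Implicit Types (x y z : galg F G) (g h : G).

Definition galg_one : galg F G := << 1 *g (1 : G)%g >>.

Definition galg_mul x y : galg F G :=
  \sum_(g <- msupp x) \sum_(h <- msupp y) << x@_g * y@_h *g (g * h)%g >>.

Lemma galg_mulEw (d1 d2 : {fset G}) x y :
    msupp x `<=` d1 -> msupp y `<=` d2 ->
  galg_mul x y
    = \sum_(g <- d1) \sum_(h <- d2) << x@_g * y@_h *g (g * h)%g >>.
Proof.
move=> le_d1 le_d2; rewrite /galg_mul (big_fset_incl _ le_d1) /=.
  apply/eq_bigr=> g _; apply/big_fset_incl => // h _ /mcoeff_outdom ->.
  by rewrite mulr0 monalgU0.
move=> g _ /mcoeff_outdom xg.
by rewrite big1 => // h _; rewrite xg mul0r monalgU0.
Qed.

Lemma galg_mulUU c d g h :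
  galg_mul << c *g g >> << d *g h >> = << c * d *g (g * h)%g >>.
Proof. by rewrite (galg_mulEw msuppU_le msuppU_le) !big_seq_fset1 !mcoeffUU. Qed.

Lemma galg_mulDl : left_distributive galg_mul +%R.
Proof.
move=> x y z.
rewrite (galg_mulEw (msuppD_le _ _) (fsubset_refl _)).
rewrite (galg_mulEw (fsubsetUl _ (msupp y)) (fsubset_refl _)).
rewrite (galg_mulEw (fsubsetUr (msupp x) _) (fsubset_refl _)).
rewrite -big_split /=; apply/eq_bigr=> g _.
rewrite -big_split /=; apply/eq_bigr=> h _.
by rewrite mcoeffD mulrDl monalgUD.
Qed.

Lemma galg_mulDr : right_distributive galg_mul +%R.
Proof.
move=> z x y.
rewrite (galg_mulEw (fsubset_refl _) (msuppD_le _ _)).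
rewrite (galg_mulEw (fsubset_refl _) (fsubsetUl _ (msupp y))).
rewrite (galg_mulEw (fsubset_refl _) (fsubsetUr (msupp x) _)).
rewrite -big_split /=; apply/eq_bigr=> g _.
rewrite -big_split /=; apply/eq_bigr=> h _.
by rewrite mcoeffD mulrDr monalgUD.
Qed.

Lemma galg_mul0x : left_zero 0 galg_mul.
Proof. by move=> x; rewrite /galg_mul msupp0 big_seq_fset0. Qed.

Lemma galg_mulx0 : right_zero 0 galg_mul.
Proof.
by move=> x; rewrite /galg_mul big1 // => g _; rewrite msupp0 big_seq_fset0.
Qed.

Lemma galg_mul_suml (I : Type) (r : seq I) (E : I -> galg F G) y :
  galg_mul (\sum_(i <- r) E i) y = \sum_(i <- r) galg_mul (E i) y.
Proof.
exact: (big_morph (galg_mul^~ y) (fun _ _ => galg_mulDl _ _ _) (galg_mul0x y)).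
Qed.

Lemma galg_mul_sumr (I : Type) (r : seq I) (E : I -> galg F G) x :
  galg_mul x (\sum_(i <- r) E i) = \sum_(i <- r) galg_mul x (E i).
Proof.
exact: (big_morph (galg_mul x) (fun _ _ => galg_mulDr _ _ _) (galg_mulx0 x)).
Qed.

Lemma galg_ind (P : galg F G -> Prop) :
    P 0 -> (forall x y, P x -> P y -> P (x + y)) ->
    (forall c g, P << c *g g >>) ->
  forall x, P x.
Proof.
move=> P0 PD PU x; rewrite [x]monalgE.
by apply: big_ind => // g _; apply: PU.
Qed.

Lemma galg_mulA : associative galg_mul.
Proof.
move=> x y z; elim/galg_ind: x => [|x x' IHx IHx'|c g].
- by rewrite !galg_mul0x.
- by rewrite !galg_mulDl IHx IHx'.
elim/galg_ind: y => [|y y' IHy IHy'|d h].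
- by rewrite galg_mulx0 !galg_mul0x galg_mulx0.
- by rewrite galg_mulDl !galg_mulDr galg_mulDl IHy IHy'.
elim/galg_ind: z => [|z z' IHz IHz'|e k].
- by rewrite !galg_mulx0.
- by rewrite !galg_mulDr IHz IHz'.
by rewrite !galg_mulUU mulrA mulgA.
Qed.

Lemma galg_mul1x : left_id galg_one galg_mul.
Proof.
elim/galg_ind => [|x y IHx IHy|c g]; first exact: galg_mulx0.
  by rewrite galg_mulDr IHx IHy.
by rewrite galg_mulUU mul1r mul1g.
Qed.

Lemma galg_mulx1 : right_id galg_one galg_mul.
Proof.
elim/galg_ind => [|x y IHx IHy|c g]; first exact: galg_mul0x.
  by rewrite galg_mulDl IHx IHy.
by rewrite galg_mulUU mulr1 mulg1.
Qed.

Lemma galg_one_neq0 : galg_one != 0.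
Proof. by rewrite monalgU_eq0 oner_eq0. Qed.

HB.instance Definition _ := GRing.Zmodule_isNzRing.Build (galg F G)
  galg_mulA galg_mul1x galg_mulx1 galg_mulDl galg_mulDr galg_one_neq0.

Lemma galgMUU c d g h :
  (<< c *g g >> : galg F G) * << d *g h >> = << c * d *g (g * h)%g >>.
Proof. exact: galg_mulUU. Qed.

Lemma galg1E : (1 : galg F G) = << 1 *g (1 : G)%g >>.
Proof. by []. Qed.

Lemma galgZU (a c : F) g : a *: (<< c *g g >> : galg F G) = << a * c *g g >>.
Proof. by apply/malgP=> h; rewrite mcoeffZ !mcoeffU mulrnAr. Qed.

Lemma galg_scaleAl (a : F) x y : a *: (x * y) = (a *: x) * y.
Proof.
elim/galg_ind: x => [|x x' IHx IHx'|c g].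
- by rewrite mul0r !scaler0 mul0r.
- by rewrite mulrDl !scalerDr mulrDl IHx IHx'.
elim/galg_ind: y => [|y y' IHy IHy'|d h].
- by rewrite !mulr0 scaler0.
- by rewrite !mulrDr scalerDr IHy IHy'.
by rewrite galgMUU !galgZU galgMUU mulrA.
Qed.

HB.instance Definition _ :=
  GRing.Lmodule_isLalgebra.Build F (galg F G) galg_scaleAl.

Lemma galg_scaleAr (a : F) x y : a *: (x * y) = x * (a *: y).
Proof.
elim/galg_ind: x => [|x x' IHx IHx'|c g].
- by rewrite !mul0r scaler0.
- by rewrite !mulrDl scalerDr IHx IHx'.
elim/galg_ind: y => [|y y' IHy IHy'|d h].
- by rewrite mulr0 !scaler0 mulr0.
- by rewrite mulrDr !scalerDr mulrDr IHy IHy'.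
by rewrite !(galgMUU, galgZU) mulrCA.
Qed.

HB.instance Definition _ :=
  GRing.Lalgebra_isAlgebra.Build F (galg F G) galg_scaleAr.

(* Invertibility in FG is not decidable in general (G may be infinite): the   *)
(* unit predicate and the inverse are obtained from classical choice.         *)
Definition galg_unit : pred (galg F G) :=
  fun x => `[< exists y, y * x = 1 /\ x * y = 1 >].

Definition galg_inv x : galg F G :=
  if pselect (exists y, y * x = 1 /\ x * y = 1) is left ex
  then projT1 (cid ex) else x.

Lemma galg_mulVx : {in galg_unit, left_inverse 1 galg_inv *%R}.
Proof.
move=> x /asboolP ex; rewrite /galg_inv; case: pselect => // ex'.
by case: cid => y /= [].
Qed.

Lemma galg_mulxV : {in galg_unit, right_inverse 1 galg_inv *%R}.
Proof.
move=> x /asboolP ex; rewrite /galg_inv; case: pselect => // ex'.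
by case: cid => y /= [].
Qed.

Lemma galg_unitP x y : y * x = 1 /\ x * y = 1 -> galg_unit x.
Proof. by move=> xy1; apply/asboolP; exists y. Qed.

Lemma galg_inv_out : {in [predC galg_unit], galg_inv =1 id}.
Proof.
move=> x nx; rewrite /galg_inv; case: pselect => // ex.
by case/negP: nx; apply/asboolP.
Qed.

HB.instance Definition _ := GRing.NzRing_hasMulInverse.Build (galg F G)
  galg_mulVx galg_mulxV galg_unitP galg_inv_out.

Definition augmentation x : F := \sum_(g <- msupp x) x@_g.

Definition star x : galg F G := \sum_(g <- msupp x) << x@_g *g (g^-1)%g >>.

Lemma augmentationD x y :
  augmentation (x + y) = augmentation x + augmentation y.
Proof.
have E z : augmentation z = mmap idfun (fun=> 1) z.
  by rewrite mmapE; apply/eq_bigr => g _; rewrite mulr1.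
by rewrite !E mmapD.
Qed.

Lemma augmentation0 : augmentation 0 = 0.
Proof. by rewrite /augmentation msupp0 big_seq_fset0. Qed.

Lemma augmentationU c g : augmentation << c *g g >> = c.
Proof.
rewrite /augmentation msuppU; case: eqP => [->|_].
  by rewrite big_seq_fset0.
by rewrite big_seq_fset1 mcoeffUU.
Qed.

Lemma augmentationM x y :
  augmentation (x * y) = augmentation x * augmentation y.
Proof.
elim/galg_ind: x => [|x x' IHx IHx'|c g].
- by rewrite mul0r augmentation0 mul0r.
- by rewrite mulrDl !augmentationD mulrDl IHx IHx'.
elim/galg_ind: y => [|y y' IHy IHy'|d h].
- by rewrite mulr0 augmentation0 mulr0.
- by rewrite mulrDr !augmentationD mulrDr IHy IHy'.
by rewrite galgMUU !augmentationU.
Qed.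

Lemma augmentation1 : augmentation 1 = 1.
Proof. exact: augmentationU. Qed.

Lemma starE x g : (star x)@_g = x@_(g^-1)%g.
Proof.
rewrite /star raddf_sum /=.
under eq_bigr => h _ do rewrite mcoeffU -[in _ == g](invgK g) (inj_eq invg_inj).
have [gx|gx] := msuppP x (g^-1)%g; last first.
  rewrite big1_fset // => h hx _.
  by case: eqP gx => // <-; rewrite hx.
rewrite (big_fsetD1 _ gx) /= eqxx mulr1n big1_fset ?addr0 // => h.
by rewrite in_fsetD1 => /andP[/negPf->].
Qed.

Lemma star0 : star 0 = 0.
Proof. by rewrite /star msupp0 big_seq_fset0. Qed.

Lemma starD x y : star (x + y) = star x + star y.
Proof. by apply/malgP => g; rewrite !(starE, mcoeffD). Qed.

Lemma starU c g : star << c *g g >> = << c *g (g^-1)%g >>.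
Proof.
by apply/malgP => h; rewrite starE !mcoeffU -[in LHS](inj_eq invg_inj) invgK.
Qed.

Lemma star1 : star 1 = 1.
Proof. by rewrite galg1E starU invg1. Qed.

Lemma starM x y : star (x * y) = star y * star x.
Proof.
elim/galg_ind: x => [|x x' IHx IHx'|c g].
- by rewrite mul0r star0 mulr0.
- by rewrite mulrDl !starD mulrDr IHx IHx'.
elim/galg_ind: y => [|y y' IHy IHy'|d h].
- by rewrite mulr0 star0 mul0r.
- by rewrite mulrDr !starD mulrDl IHy IHy'.
by rewrite galgMUU !starU galgMUU mulrC invgM.
Qed.

Lemma starK : involutive star.
Proof. by move=> x; apply/malgP => g; rewrite !starE invgK. Qed.

Record normalized_unit := NormalizedUnit {
  nunit_val : galg F G;
  _ : (nunit_val \is a GRing.unit) && (augmentation nunit_val == 1) }.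

HB.instance Definition _ := [isSub for nunit_val].
HB.instance Definition _ := [Choice of normalized_unit by <:].

Implicit Types u v w : normalized_unit.

Lemma nunit_unit u : val u \is a GRing.unit.
Proof. by case/andP: (valP u). Qed.

Lemma nunit_augmentation u : augmentation (val u) = 1.
Proof. by case/andP: (valP u) => _ /eqP. Qed.

Lemma nunit_one_subproof :
  ((1 : galg F G) \is a GRing.unit) && (augmentation 1 == 1).
Proof. by rewrite unitr1 augmentation1 eqxx. Qed.

Lemma nunit_mul_subproof u v :
  (val u * val v \is a GRing.unit) && (augmentation (val u * val v) == 1).
Proof.
by rewrite augmentationM !nunit_augmentation mulr1 eqxx unitrMl ?nunit_unit.
Qed.

Lemma nunit_inv_subproof u :
  ((val u)^-1 \is a GRing.unit) && (augmentation (val u)^-1 == 1).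
Proof.
rewrite unitrV nunit_unit /=; apply/eqP.
rewrite -[LHS]mul1r -{1}(nunit_augmentation u) -augmentationM.
by rewrite mulrV ?nunit_unit ?augmentation1.
Qed.

Definition nunit_one := NormalizedUnit nunit_one_subproof.
Definition nunit_mul u v := NormalizedUnit (nunit_mul_subproof u v).
Definition nunit_inv u := NormalizedUnit (nunit_inv_subproof u).

Lemma nunit_mulA : associative nunit_mul.
Proof. by move=> u v w; apply/val_inj/mulrA. Qed.

Lemma nunit_mul1u : left_id nunit_one nunit_mul.
Proof. by move=> u; apply/val_inj/mul1r. Qed.

Lemma nunit_mulu1 : right_id nunit_one nunit_mul.
Proof. by move=> u; apply/val_inj/mulr1. Qed.

Lemma nunit_mulVu : left_inverse nunit_one nunit_inv nunit_mul.
Proof. by move=> u; apply/val_inj/mulVr/nunit_unit. Qed.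

Lemma nunit_muluV : right_inverse nunit_one nunit_inv nunit_mul.
Proof. by move=> u; apply/val_inj/mulrV/nunit_unit. Qed.

HB.instance Definition _ := isGroup.Build normalized_unit
  nunit_mulA nunit_mul1u nunit_mulu1 nunit_mulVu nunit_muluV.

Definition unitary : pred normalized_unit :=
  fun u => (val u)^-1 == star (val u).

Lemma unitary_closed : group_closed unitary.
Proof.
have sV u : u \in unitary -> star (val u) = (val u)^-1 by move/eqP.
split=> [|u v uU vU]; first by rewrite unfold_in /= /unitary /= invr1 star1.
rewrite unfold_in /unitary /=.
rewrite starM -(sV v vU) starK (sV u uU) sV // invrM ?unitrV ?nunit_unit //.
by rewrite invrK.
Qed.

Record unitary_unit := UnitaryUnit {
  uunit_val : normalized_unit;
  _ : unitary uunit_val }.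

HB.instance Definition _ := [isSub for uunit_val].
HB.instance Definition _ := [Choice of unitary_unit by <:].
HB.instance Definition _ :=
  SubChoice_isSubGroup.Build normalized_unit unitary unitary_unit
    unitary_closed.

End GroupAlgebraRing.

Definition group_isomorphic (A B : groupType) : Prop :=
  exists f : {multiplicative A -> B}, bijective f.

(* Main.v *)
Require Import Defs.
From HB Require Import structures.
From mathcomp Require Import all_boot all_order all_fingroup all_algebra.
From mathcomp Require Import all_solvable.
From mathcomp Require Import finmap boolp ring.
From mathcomp.multinomials Require Import monalg.

Set Implicit Arguments.
Unset Strict Implicit.
Unset Printing Implicit Defensive.

Import GRing.Theory.
Local Open Scope ring_scope.

(** Write $FK$ for the elements of $FG$ supported on a subgroup $K$, $x^!$ for
    the image of $x$ under the classical involution, $V_!(FK)$ for the unitary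
    elements with support in $K$, and $U(K)$ for the group generated by $K$ and
    by the quotients $y / y^!$ with $y \in FK$ of augmentation $1$. Every
    element of $U(K)$ is unitary. The proof rests on the identity
    $V_!(FK)^p = U(K^p)$ ([unitaries_exprp]).

    Since $F$ is perfect, the Frobenius map sends $FK$ onto $F[K^p]$, so that
    $U(K)^p = U(K^p)$. With the identity, $V_!(FG)^{p^i} = U(G^{p^i})$ for
    $i > 0$. Hence the order of $V_!(FG)^{p^i}$ depends only on $G^{p^i}$, and
    it grows strictly when that group is embedded properly into another one.
    If $V_!(FG)$ and $V_!(FH)$ are isomorphic, then $H$, which embeds into
    $V_!(FH)$, is a finite abelian $p$-group, and descending induction on $i$
    shows $|G^{p^i}| = |H^{p^i}|$: when the orders agree for all larger
    exponents, the smaller of $G^{p^i}$ and $H^{p^i}$ embeds into the other one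
    ([abelian_embedding]), and the embedding is onto because the groups $U$, or
    $V_!$ if $i = 0$, have the same order. These orders determine $G$.

    For odd $p$ the identity is Hilbert 90: a unitary $x$ is $y / y^!$ with
    $y = (1 + x) / 2$ ([unitaries_odd]). For $p = 2$ the idea is that the
    equation $x x^! = 1$ can be halved. The coefficients of $x x^!$ at $g$ and
    $g^{-1}$ agree, and adding one of each pair of them over the fibre
    $g^2 = k$ shows that $c = x^2$ is a zero of the quadratic form $q_k$ which
    sums $c_h c_{kh}$ over the unordered pairs $\{h, kh\}$, for each
    involution $k$ ([pair_form_unitary_sqr]). By induction on $K$ one may
    divide $x$ by an element of $U(K)$ to reach $c^2 = 1$; then $c = c^!$, and
    $c = e + r + r^!$ where $e$ is the part of $c$ on the elements of order at
    most $2$. For this $c$ one finds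
    $q_k(c) = q_k(e) + (\sum_{h^2 = k} r_h)^2$. The forms with $k \notin K^4$
    therefore vanish at $e$ and force $e$ into one coset of $K^4$
    ([support_coset]), so that $e$ becomes $1$ after multiplication by an
    element of $U(K^2)$. The remaining forms then say that $r$ can be chosen
    with $r^2 = 0$. A count shows that $1 + r + r^!$ is a norm
    $(1 + f)(1 + f)^!$ with $f^2 = 0$ ([sqr0_norm_surj]); as $1 + f$ is its own
    inverse, this norm is $y / y^!$ for $y = (1 + f)^!$. *)

(** * The group algebra of a finite abelian group *)

Section Abelian.
Variables (F : finFieldType) (G : finGroupType).

Lemma galg_mulC (cG : abelian [set: G]) : commutative (@galg_mul F G).
Proof.
move=> x y; rewrite /galg_mul exchange_big /=.
apply: eq_bigr => g _; apply: eq_bigr => h _.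
by rewrite mulrC (centsP cG) ?inE.
Qed.

(** The proof of commutativity is a parameter of the type, so that the group
    algebra can carry a commutative ring structure. *)
Definition abgalg (cG : abelian [set: G]) : Type := galg F G.

Variable cG : abelian [set: G].
Local Notation A := (abgalg cG).

HB.instance Definition _ := GRing.Lmodule.copy A (galg F G).

(** Product, inverse and, below, involution are locked: they unfold to sums over
    supports and to classical choice, on which conversion tests do not end in
    reasonable time. *)
Definition abgalg_mul : A -> A -> A := locked (@galg_mul F G).
Definition abgalg_inv : A -> A := locked (@galg_inv F G).

Lemma abgalg_mulE : abgalg_mul = @galg_mul F G.
Proof. by rewrite /abgalg_mul -lock. Qed.
Lemma abgalg_invE : abgalg_inv = @galg_inv F G.
Proof. by rewrite /abgalg_inv -lock. Qed.

Fact abgalg_mulA : associative abgalg_mul.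
Proof. by rewrite abgalg_mulE; apply: galg_mulA. Qed.
Fact abgalg_mulC : commutative abgalg_mul.
Proof. by rewrite abgalg_mulE; apply: galg_mulC. Qed.
Fact abgalg_mul1x : left_id (galg_one F G) abgalg_mul.
Proof. by rewrite abgalg_mulE; apply: galg_mul1x. Qed.
Fact abgalg_mulDl : left_distributive abgalg_mul +%R.
Proof. by rewrite abgalg_mulE; apply: galg_mulDl. Qed.
HB.instance Definition _ := GRing.Zmodule_isComNzRing.Build A
  abgalg_mulA abgalg_mulC abgalg_mul1x abgalg_mulDl (galg_one_neq0 F G).

Fact abgalg_scaleAl (a : F) (x y : A) :
  a *: abgalg_mul x y = abgalg_mul (a *: x) y.
Proof. by rewrite abgalg_mulE; apply: galg_scaleAl. Qed.
HB.instance Definition _ := GRing.Lmodule_isLalgebra.Build F A abgalg_scaleAl.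

HB.instance Definition _ := GRing.Lalgebra_isComAlgebra.Build F A.

Definition abgalg_unit : pred A := @galg_unit F G.
Fact abgalg_mulVx : {in abgalg_unit, left_inverse (galg_one F G) abgalg_inv abgalg_mul}.
Proof. by rewrite abgalg_mulE abgalg_invE; apply: galg_mulVx. Qed.
Fact abgalg_unitP (x y : A) : abgalg_mul y x = galg_one F G -> abgalg_unit x.
Proof.
rewrite abgalg_mulE => yx.
apply: (galg_unitP (y := y)); split=> //.
by rewrite [RHS](esym yx); apply: galg_mulC.
Qed.
Fact abgalg_inv_out : {in [predC abgalg_unit], abgalg_inv =1 id}.
Proof. by rewrite abgalg_invE; apply: galg_inv_out. Qed.
HB.instance Definition _ := GRing.ComNzRing_hasMulInverse.Build A
  abgalg_mulVx abgalg_unitP abgalg_inv_out.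

Lemma abgalgM (x y : A) : x * y = (x : galg F G) * (y : galg F G).
Proof. by rewrite -[RHS]/(galg_mul x y) -abgalg_mulE. Qed.

Lemma abgalgX (x : A) n : x ^+ n = (x : galg F G) ^+ n.
Proof. by elim: n => // n IHn; rewrite !exprS abgalgM IHn. Qed.

Definition gcoef (x : A) (g : G) : F := mcoeff g x.
Definition abgalg_of_ffun (f : {ffun G -> F}) : A := \sum_g << f g *g g >>.
Definition ffun_of_abgalg (x : A) : {ffun G -> F} := [ffun g => gcoef x g].
Lemma ffun_of_abgalgK : cancel ffun_of_abgalg abgalg_of_ffun.
Proof.
move=> x; apply/malgP => h; rewrite /abgalg_of_ffun raddf_sum /= (bigD1 h) //= big1.
  by rewrite mcoeffU eqxx addr0 ffunE.
by move=> g /negPf ngh; rewrite mcoeffU ngh.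
Qed.
HB.instance Definition _ : isCountable A := CanIsCountable ffun_of_abgalgK.
HB.instance Definition _ : isFinite A := CanIsFinite ffun_of_abgalgK.

Implicit Types (x y z u v w : A) (g h k : G) (a b : F).

Definition mon g : A := << 1 *g g >>.
Definition conj : A -> A := locked (@star F G).
Lemma conjE : conj = @star F G. Proof. by rewrite /conj -lock. Qed.
Definition aug x : F := augmentation x.
Local Notation "x ^!" := (conj x) (at level 1, format "x ^!").

Lemma gcoefP x y : (forall g, gcoef x g = gcoef y g) -> x = y.
Proof. by move=> e; apply/malgP. Qed.

Lemma gcoef0 g : gcoef 0 g = 0. Proof. exact: mcoeff0. Qed.
Lemma gcoefD g x y : gcoef (x + y) g = gcoef x g + gcoef y g.
Proof. exact: mcoeffD. Qed.
Lemma gcoefN g x : gcoef (- x) g = - gcoef x g.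
Proof. exact: mcoeffN. Qed.
Lemma gcoefZ a x g : gcoef (a *: x) g = a * gcoef x g.
Proof. exact: mcoeffZ. Qed.
Lemma gcoef_sum (I : Type) (r : seq I) (P : pred I) (E : I -> A) g :
  gcoef (\sum_(i <- r | P i) E i) g = \sum_(i <- r | P i) gcoef (E i) g.
Proof. exact: (big_morph _ (gcoefD g) (gcoef0 g)). Qed.
Lemma gcoef_mon h g : gcoef (mon h) g = (h == g)%:R.
Proof. exact: mcoeffU. Qed.
Lemma mon1 : mon 1%g = 1. Proof. by []. Qed.
Lemma gcoef1 g : gcoef 1 g = (g == 1%g)%:R.
Proof. by rewrite -mon1 gcoef_mon eq_sym. Qed.
Lemma monM g h : mon (g * h)%g = mon g * mon h.
Proof. by rewrite abgalgM [RHS]galgMUU mulr1. Qed.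

Lemma monX g n : mon (g ^+ n)%g = mon g ^+ n.
Proof. by elim: n => // n IHn; rewrite expgS exprS monM IHn. Qed.

Lemma abgalg_expand x : x = \sum_g gcoef x g *: mon g.
Proof.
apply: gcoefP => h; rewrite gcoef_sum (bigD1 h) //= big1.
  by rewrite gcoefZ gcoef_mon eqxx mulr1 addr0.
by move=> g /negPf gh; rewrite gcoefZ gcoef_mon gh mulr0.
Qed.

Lemma gcoef_monM h x g : gcoef (mon h * x) g = gcoef x (h^-1 * g)%g.
Proof.
rewrite [in LHS](abgalg_expand x) mulr_sumr gcoef_sum.
rewrite (bigD1 (h^-1 * g)%g) //= big1 => [|k].
  by rewrite -scalerAr -monM mulKVg gcoefZ gcoef_mon eqxx mulr1 addr0.
rewrite -scalerAr -monM gcoefZ gcoef_mon => /negPf nk.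
by rewrite -(inj_eq (mulgI h^-1%g)) mulKg nk mulr0.
Qed.

Lemma gcoefM x y g : gcoef (x * y) g = \sum_h gcoef x h * gcoef y (h^-1 * g)%g.
Proof.
rewrite [in LHS](abgalg_expand x) mulr_suml gcoef_sum.
by apply: eq_bigr => h _; rewrite -scalerAl gcoefZ gcoef_monM.
Qed.

Lemma gcoef_conj x g : gcoef x^! g = gcoef x g^-1%g.
Proof. by rewrite conjE; apply: starE. Qed.

Fact conj_zmod_morphism : zmod_morphism conj.
Proof.
by move=> x y; apply: gcoefP => g; rewrite !(gcoef_conj, gcoefD, gcoefN).
Qed.
HB.instance Definition _ :=
  GRing.isZmodMorphism.Build A A conj conj_zmod_morphism.

Fact conj_monoid_morphism : monoid_morphism conj.
Proof.
by rewrite conjE; split=> [|x y]; [exact: star1 | rewrite mulrC !abgalgM; exact: starM].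
Qed.
HB.instance Definition _ :=
  GRing.isMonoidMorphism.Build A A conj conj_monoid_morphism.

Lemma conjK : involutive conj. Proof. by rewrite conjE; apply: starK. Qed.
Lemma conjZ a x : (a *: x)^! = a *: x^!.
Proof. by apply: gcoefP => g; rewrite !(gcoef_conj, gcoefZ). Qed.
Lemma conj_mon g : (mon g)^! = mon g^-1%g. Proof. by rewrite conjE; apply: starU. Qed.

Lemma augE x : aug x = \sum_g gcoef x g.
Proof.
rewrite {1}[x]abgalg_expand /aug.
rewrite (big_morph (@augmentation F G) (@augmentationD F G) (@augmentation0 F G)).
by apply: eq_bigr => g _; rewrite /mon [_ *: _]galgZU augmentationU mulr1.
Qed.

Fact aug_zmod_morphism : zmod_morphism aug.
Proof.
move=> x y; rewrite !augE -sumrB.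
by apply: eq_bigr => g _; rewrite !(gcoefD, gcoefN).
Qed.
HB.instance Definition _ :=
  GRing.isZmodMorphism.Build A F aug aug_zmod_morphism.
Fact aug_monoid_morphism : monoid_morphism aug.
Proof.
by split=> [|x y]; [exact: augmentation1 | rewrite abgalgM; exact: augmentationM].
Qed.
HB.instance Definition _ :=
  GRing.isMonoidMorphism.Build A F aug aug_monoid_morphism.

Lemma augZ a x : aug (a *: x) = a * aug x.
Proof. by rewrite !augE mulr_sumr; apply: eq_bigr => g _; rewrite gcoefZ. Qed.
Lemma aug_mon g : aug (mon g) = 1. Proof. exact: augmentationU. Qed.
Lemma aug_conj x : aug x^! = aug x.
Proof.
rewrite !augE (reindex_inj invg_inj) /=.
by apply: eq_bigr => g _; rewrite gcoef_conj invgK.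
Qed.

Definition supported (K : {group G}) : {pred A} :=
  [pred x | [forall g, (gcoef x g != 0) ==> (g \in K)]].

Lemma supportedP (K : {group G}) x :
  reflect (forall g, g \notin K -> gcoef x g = 0) (x \in supported K).
Proof.
apply: (iffP forallP) => [sx g | sx g].
  by move: (sx g); case: eqP => //= _ ->.
by apply/implyP; apply: contraR => /sx->.
Qed.

Lemma mem_supported_mon (K : {group G}) g : (mon g \in supported K) = (g \in K).
Proof.
apply/supportedP/idP => [sg | Kg h].
  by apply: contraTT isT => /sg/eqP; rewrite gcoef_mon eqxx oner_eq0.
by rewrite gcoef_mon; case: eqP => // <-; rewrite Kg.
Qed.

Fact supported_submod_closed K : submod_closed (supported K).
Proof.
split=> [|a x y /supportedP sx /supportedP sy].
  by apply/supportedP => g _; rewrite gcoef0.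
by apply/supportedP => g ng; rewrite gcoefD gcoefZ sx // sy // mulr0 addr0.
Qed.

Lemma supported_expand (K : {group G}) x : x \in supported K ->
  x = \sum_(g in K) gcoef x g *: mon g.
Proof.
move/supportedP=> sx; rewrite {1}[x]abgalg_expand [RHS]big_mkcond /=.
by apply: eq_bigr => g _; case: ifPn => // /sx->; rewrite scale0r.
Qed.

Fact supported_subalg_closed K : subalg_closed (supported K).
Proof.
have [s0 sD] := supported_submod_closed K; split=> //.
  by rewrite -mon1 mem_supported_mon group1.
move=> x y sx sy; apply/supportedP => g ng.
rewrite gcoefM big1 // => h _; have [Kh|nKh] := boolP (h \in K).
  by rewrite (supportedP _ _ sy) ?mulr0 // groupMl ?groupV.
by rewrite (supportedP _ _ sx) ?mul0r.
Qed.
HB.instance Definition _ (K : {group G}) :=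
  GRing.isSubalgClosed.Build F A (supported K) (supported_subalg_closed K).

Lemma supported_conj (K : {group G}) x : x \in supported K -> x^! \in supported K.
Proof.
by move/supportedP=> sx; apply/supportedP => g ng; rewrite gcoef_conj sx ?groupV.
Qed.

Lemma supportedS (K L : {group G}) x :
  K \subset L -> x \in supported K -> x \in supported L.
Proof.
move=> sKL /supportedP sx; apply/supportedP => g ng.
by rewrite sx //; apply: contra ng; apply: (subsetP sKL).
Qed.

Lemma supported_all (K : {group G}) x : [set: G] \subset K -> x \in supported K.
Proof. by move=> sK; apply/supportedP => g; rewrite (subsetP sK) ?inE. Qed.

Variable p : nat.
Hypothesis pcharF : p \in [pchar F].

Lemma pchar_abgalg : p \in [pchar A].
Proof.
rewrite inE (pcharf_prime pcharF) /=; apply/eqP/gcoefP => g.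
by rewrite -mulr_natr mul1r -scaler_nat gcoefZ (pcharf0 pcharF) mul0r gcoef0.
Qed.

Lemma exprpn_sum (I : finType) (P : pred I) (E : I -> A) n :
  (\sum_(i | P i) E i) ^+ (p ^ n) = \sum_(i | P i) E i ^+ (p ^ n).
Proof.
have p_n : [pchar A].-nat (p ^ n)%N.
  by rewrite pnatX (pi_pnat (pnat_id (pcharf_prime pcharF))) ?pchar_abgalg.
elim/big_rec2: _ => [|i y x _ <-]; last exact: exprDn_pchar.
by rewrite expr0n expn_eq0 eqn0Ngt prime_gt0 ?(pcharf_prime pcharF).
Qed.

Lemma exprpn_expand x n :
  x ^+ (p ^ n) = \sum_g gcoef x g ^+ (p ^ n) *: mon (g ^+ (p ^ n))%g.
Proof.
rewrite {1}[x]abgalg_expand exprpn_sum; apply: eq_bigr => g _.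
by rewrite exprZn monX.
Qed.

Lemma exprp_expand x : x ^+ p = \sum_g gcoef x g ^+ p *: mon (g ^+ p)%g.
Proof. by have := exprpn_expand x 1; rewrite expn1. Qed.

(** Frobenius pushes $x$ forward along $g \mapsto g^p$ and raises the sums over
    the fibres to the power $p$, since it is additive. *)
Lemma gcoef_exprp x k :
  gcoef (x ^+ p) k = (\sum_(g | (g ^+ p == k)%g) gcoef x g) ^+ p.
Proof.
rewrite exprp_expand gcoef_sum -(pFrobenius_autE pcharF) rmorph_sum /=.
rewrite [RHS]big_mkcond /=; apply: eq_bigr => g _.
by rewrite gcoefZ gcoef_mon pFrobenius_autE; case: eqP; rewrite ?mulr1 ?mulr0.
Qed.

Hypothesis pG : (p.-group [set: G])%g.

(** For $p^n \ge |G|$ all group elements have the same $p^n$-th power $1$: the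
    group algebra is local, and an element is a unit as soon as its augmentation
    is not $0$. *)
Lemma exprpn_aug n x : (#|G| <= p ^ n)%N -> x ^+ (p ^ n) = (aug x ^+ (p ^ n))%:A.
Proof.
move=> leGpn; have [m cG'] := p_natP pG.
have G1 g : (g ^+ (p ^ n))%g = 1%g.
  apply/eqP; rewrite -order_dvdn.
  apply: dvdn_trans (order_dvdG (in_setT g)) _.
  rewrite cG' dvdn_exp2l // -(leq_exp2l _ _ (prime_gt1 (pcharf_prime pcharF))).
  by rewrite -cG' cardsT.
rewrite exprpn_expand; under eq_bigr => g _ do rewrite G1 mon1.
rewrite -scaler_suml augE; congr (_ *: _).
have p_n : [pchar F].-nat (p ^ n)%N.
  by rewrite pnatX (pi_pnat (pnat_id (pcharf_prime pcharF))) ?pcharF.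
elim/big_rec2: _ => [|i y z _ ->]; last by rewrite exprDn_pchar.
by rewrite expr0n expn_eq0 eqn0Ngt prime_gt0 ?(pcharf_prime pcharF).
Qed.

Lemma expr_aug1 x : aug x = 1 -> x ^+ (p ^ #|G|) = 1.
Proof.
move=> ax; rewrite exprpn_aug ?ax ?expr1n ?scale1r //.
by rewrite ltnW // ltn_expl // prime_gt1 // (pcharf_prime pcharF).
Qed.

Lemma unit_aug1 x : aug x = 1 -> x \is a GRing.unit.
Proof.
move=> /expr_aug1 x1; rewrite -(unitrX_pos _ (n := (p ^ #|G|)%N)) ?x1 ?unitr1 //.
by rewrite expn_gt0 prime_gt0 // (pcharf_prime pcharF).
Qed.

Lemma aug_inv x : aug x = 1 -> aug x^-1 = 1.
Proof. by move=> ax; rewrite rmorphV ?unit_aug1 //= ax invr1. Qed.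

Lemma supported_inv (K : {group G}) x :
  aug x = 1 -> x \in supported K -> x^-1 \in supported K.
Proof.
move=> ax sx; have Ux := unit_aug1 ax.
suff -> : x^-1 = x ^+ (p ^ #|G|).-1 by rewrite rpredX.
apply: (mulrI Ux); rewrite divrr // -exprS prednK ?expr_aug1 //.
by rewrite expn_gt0 prime_gt0 // (pcharf_prime pcharF).
Qed.

Lemma Mho1E (K : {group G}) : 'Mho^1(K)%g = [set (g ^+ p)%g | g in K].
Proof.
have pK : (p.-group K)%g := pgroupS (subsetT K) pG.
by rewrite (MhoEabelian _ pK (abelianS (subsetT K) cG)) expn1.
Qed.

Lemma Mho1P (K : {group G}) k :
  reflect (exists2 g, g \in K & k = (g ^+ p)%g) (k \in 'Mho^1(K)%G).
Proof. by rewrite [k \in _]/= Mho1E; apply: imsetP. Qed.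

Lemma supported_exprp (K : {group G}) y :
  y \in supported K -> y ^+ p \in supported 'Mho^1(K)%G.
Proof.
move/supported_expand->; have := exprpn_sum (mem K) (fun g => gcoef y g *: mon g) 1.
rewrite expn1 => ->; apply: rpred_sum => g Kg.
by rewrite exprZn -monX rpredZ // mem_supported_mon; apply/Mho1P; exists g.
Qed.

(** $F$ is perfect, so roots of the coefficients and of the group elements can be
    chosen separately. *)
Lemma exprp_surj (K : {group G}) x : x \in supported 'Mho^1(K)%G ->
  exists2 y, y \in supported K & y ^+ p = x.
Proof.
move/supported_expand => xE.
have ex_root a : exists b, b ^+ p == a.
  exists (invF (fmorph_inj (pFrobenius_aut pcharF)) a).
  by rewrite -(pFrobenius_autE pcharF) f_invF.
pose rt a := xchoose (ex_root a).
have rtK a : rt a ^+ p = a by apply/eqP/(xchooseP (ex_root a)).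
pose sq k := odflt 1%g [pick g in K | (g ^+ p)%g == k].
have sqP k : k \in 'Mho^1(K)%G -> sq k \in K /\ (sq k ^+ p)%g = k.
  rewrite /sq => /Mho1P[g Kg ->].
  by case: pickP => [h /andP[Kh /eqP] | /(_ g)]; rewrite ?Kg ?eqxx.
exists (\sum_(k in 'Mho^1(K)%g) rt (gcoef x k) *: mon (sq k)).
  apply: rpred_sum => k /sqP[Kk _]; by rewrite rpredZ // mem_supported_mon.
have := exprpn_sum (mem ('Mho^1(K))%g) (fun k => rt (gcoef x k) *: mon (sq k)) 1.
rewrite expn1 => ->; rewrite {2}xE.
by apply: eq_bigr => k /sqP[_ ek]; rewrite exprZn -monX ek rtK.
Qed.
End Abelian.

(** * Sums over pairs exchanged by an involution *)

Section InvolutionSums.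
Variables (R : nzRingType) (I : finType).
Implicit Types (P T : pred I) (s : I -> I) (f : I -> R).

Definition is_half s T := forall i, T (s i) = ~~ T i.

(** A choice of one element in each orbit of size two; fixed points are left
    out. *)
Definition rank_half s : pred I := fun i => (enum_rank i < enum_rank (s i))%N.

Lemma rank_halfP s i : involutive s -> s i != i ->
  rank_half s (s i) = ~~ rank_half s i.
Proof.
move=> sK ni; rewrite /rank_half sK -leqNgt [RHS]leq_eqVlt.
by rewrite (inj_eq val_inj) (inj_eq enum_rank_inj) (negPf ni).
Qed.

(** Sets of representatives of the same pairs differ by exchanging members of
    pairs, which does not affect an invariant summand. *)
Lemma half_sum_indep s f T T' : involutive s ->
  is_half s T -> is_half s T' -> (forall i, f (s i) = f i) ->
  \sum_(i | T i) f i = \sum_(i | T' i) f i.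
Proof.
move=> sK sT sT' sf; rewrite (bigID T') [RHS](bigID T) /=; congr (_ + _).
  by apply: eq_bigl => i; rewrite andbC.
rewrite (reindex_inj (inv_inj sK)) /=.
by apply: eq_big => [i|i _ //]; rewrite sT sT' negbK andbC.
Qed.

Lemma sum_free_involution s f P : 2%N \in [pchar R] -> involutive s ->
    (forall i, P (s i) = P i) -> (forall i, P i -> s i != i) ->
    (forall i, P i -> f (s i) = f i) ->
  \sum_(i | P i) f i = 0.
Proof.
move=> ch2 sK sP nfix sf; rewrite (bigID (rank_half s)) /=.
rewrite [X in _ + X](reindex_inj (inv_inj sK)) /= addrC.
under eq_bigl => i do rewrite sP.
rewrite [X in X + _](eq_big (fun i => P i && rank_half s i) f).
- exact: addrr_pchar2.
- by move=> i; case: (boolP (P i)) => //= /nfix/(rank_halfP sK)->; rewrite negbK.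
by move=> i /andP[/sf].
Qed.

End InvolutionSums.

(** * The quadratic form of an involution in characteristic two *)

Section PairForm.
Variables (F : finFieldType) (G : finGroupType) (cG : abelian [set: G]).
Hypothesis ch2 : 2%N \in [pchar F].
Local Notation A := (abgalg F cG).
Local Notation "x ^!" := (conj x) (at level 1, format "x ^!").
Implicit Types (x y z u v w r c e : A) (g h k t : G).

Let mulgC : commutative (@mulg G).
Proof. by move=> g h; apply: (centsP cG); rewrite inE. Qed.

Definition pair_half k : pred G := rank_half (mulg k).
(** For an involution $k$ this is the sum of $x_g x_{kg}$ over the unordered pairs
    $\{g, kg\}$, that is, half of the coefficient of $x x^!$ at $k$, whose
    own value is $0$ in characteristic two. *)
Definition pair_form k x : F := \sum_(g | pair_half k g) gcoef x g * gcoef x (k * g)%g.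

Lemma mulg_involution k : (k ^+ 2 = 1 -> involutive (mulg k))%g.
Proof. by move=> k2 g; rewrite mulgA -expg2 k2 mul1g. Qed.

Lemma pair_half_is_half k : (k ^+ 2 = 1)%g -> k != 1%g -> is_half (mulg k) (pair_half k).
Proof.
move=> k2 k1 g; apply: rank_halfP; first exact: mulg_involution.
by rewrite -{2}[g]mul1g (inj_eq (mulIg _)).
Qed.

Lemma pair_formE k x T : (k ^+ 2 = 1)%g -> k != 1%g -> is_half (mulg k) T ->
  pair_form k x = \sum_(g | T g) gcoef x g * gcoef x (k * g)%g.
Proof.
move=> k2 k1 kT; apply: (half_sum_indep (mulg_involution k2)) kT _ => //.
  exact: pair_half_is_half.
by move=> g; rewrite /= (mulg_involution k2) mulrC.
Qed.

Lemma pair_formD k x y : (k ^+ 2 = 1)%g -> k != 1%g ->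
  pair_form k (x + y) =
    pair_form k x + pair_form k y + \sum_g gcoef x g * gcoef y (k * g)%g.
Proof.
move=> k2 k1; rewrite [X in _ = _ + X](bigID (pair_half k)) /=.
rewrite [X in _ = _ + (_ + X)](reindex_inj (mulgI k)) /=.
under [X in _ = _ + (_ + X)]eq_bigl => g do rewrite pair_half_is_half // negbK.
rewrite -!big_split /=; apply: eq_bigr => g _.
by rewrite !gcoefD (mulg_involution k2); ring.
Qed.

Lemma pair_form_conj k x : (k ^+ 2 = 1)%g -> k != 1%g ->
  pair_form k x^! = pair_form k x.
Proof.
move=> k2 k1.
have kV : (k^-1 = k)%g by apply/eqP; rewrite eq_invg_mul -expg2 k2.
rewrite [RHS](pair_formE x k2 k1 (T := fun g => pair_half k g^-1%g)).
  rewrite [RHS](reindex_inj invg_inj) /=.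
  apply: eq_big => [g|g _]; first by rewrite invgK.
  by rewrite !gcoef_conj invgM kV mulgC.
by move=> g; rewrite invgM kV mulgC pair_half_is_half.
Qed.

Let sumX2 (I : finType) (P : pred I) (f : I -> F) :
  (\sum_(i | P i) f i) ^+ 2 = \sum_(i | P i) f i ^+ 2.
Proof. by rewrite -(pFrobenius_autE ch2) rmorph_sum. Qed.

Lemma gcoef_trace r g : (g ^+ 2 = 1)%g -> gcoef (r + r^!) g = 0.
Proof.
move=> g2; have gV : (g^-1 = g)%g by apply/eqP; rewrite eq_invg_mul -expg2 g2.
by rewrite gcoefD gcoef_conj gV addrr_pchar2.
Qed.

(** The polar form of $r$ and $r^!$ is $\sum_g r_g r_{k g^{-1}}$. Its terms at
    $g$ and $k g^{-1}$ cancel, except when these coincide, which means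
    $g^2 = k$. *)
Lemma pair_form_trace k r : (k ^+ 2 = 1)%g -> k != 1%g ->
  pair_form k (r + r^!) = (\sum_(h | (h ^+ 2)%g == k) gcoef r h) ^+ 2.
Proof.
move=> k2 k1; have kV : (k^-1 = k)%g by apply/eqP; rewrite eq_invg_mul -expg2 k2.
rewrite pair_formD // pair_form_conj // addrr_pchar2 // add0r.
have kg g : (k * g^-1 == g)%g = ((g ^+ 2)%g == k).
  by rewrite -(inj_eq (mulIg g)) mulgKV -expg2 eq_sym.
rewrite (bigID (fun g => (g ^+ 2)%g == k)) /= addrC.
rewrite [X in X + _ = _](@sum_free_involution _ _ (fun g => k * g^-1)%g) //.
- rewrite add0r sumX2; apply: eq_bigr => g.
  by rewrite gcoef_conj invgM kV mulgC -kg => /eqP->.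
- by move=> g /=; rewrite invgM invgK kV [(g * k)%g]mulgC mulgA -expg2 k2 mul1g.
- move=> g; congr negb.
  by rewrite expgMn; [rewrite k2 mul1g expVgn -{1}kV (inj_eq invg_inj) | apply: mulgC].
- by move=> g; rewrite kg.
move=> g _; rewrite !gcoef_conj !invgM !invgK !kV mulrC.
by rewrite -mulgA -expg2 k2 mulg1 [(g^-1 * _)%g]mulgC.
Qed.

(** Multiplication by $k$ preserves the set of solutions of $g^2 = 1$, where
    $r + r^!$ vanishes; so $e$ and $r + r^!$ are orthogonal for the polar
    form. *)
Lemma pair_form_decomp k e r : (k ^+ 2 = 1)%g -> k != 1%g ->
    (forall g, (g ^+ 2 != 1)%g -> gcoef e g = 0) ->
  pair_form k (e + (r + r^!)) =
    pair_form k e + (\sum_(h | (h ^+ 2)%g == k) gcoef r h) ^+ 2.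
Proof.
move=> k2 k1 e0; rewrite pair_formD // pair_form_trace //.
rewrite [X in _ + X]big1 ?addr0 // => g _.
have [g2|/e0->] := eqVneq (g ^+ 2)%g 1%g; last by rewrite mul0r.
rewrite gcoef_trace ?mulr0 // expgMn; last exact: mulgC.
by rewrite k2 g2 mulg1.
Qed.

(** By the formula for the coefficients of $x^2$, the value is the square of the
    sum of $x_g x_{g'}$ over pairs $\{g, g'\}$ with $(g' / g)^2 = k$. Sorted by
    $t = g' / g$, the contributions of $t$ and $t^{-1}$ add up to the coefficient
    of $x x^!$ at $t$, which is $0$. So they are equal, and as $t \ne t^{-1}$
    they cancel. *)
Lemma pair_form_unitary_sqr k x : (k ^+ 2 = 1)%g -> k != 1%g ->
  x * x^! = 1 -> pair_form k (x ^+ 2) = 0.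
Proof.
move=> k2 k1 xx; have kV : (k^-1 = k)%g by apply/eqP; rewrite eq_invg_mul -expg2 k2.
rewrite /pair_form; under eq_bigr => h _ do rewrite !(gcoef_exprp ch2) -exprMn.
rewrite -sumX2 (_ : \sum_(h | _) _ = 0) ?expr0n //.
(* The contribution of the pairs whose quotient is t. *)
pose f t := \sum_(g | pair_half k (g ^+ 2)%g) gcoef x g * gcoef x (t * g)%g.
transitivity (\sum_(t | (t ^+ 2)%g == k) f t); last first.
  apply: (@sum_free_involution _ _ invg) => //; first exact: invgK.
  - by move=> t; rewrite expVgn -{1}kV (inj_eq invg_inj).
  - move=> t /eqP tk; apply: contraNneq k1 => tV.
    by rewrite -tk expg2 -{1}tV mulVg.
  move=> t /eqP tk; apply/eqP; rewrite -subr_eq0 oppr_pchar2 // /f.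
  (* Replacing g by t g exchanges the two members of the pair of g^2. *)
  rewrite [X in X + _](reindex_inj (mulgI t)) /=.
  under [X in X + _]eq_big => [g|g _].
    rewrite expgMn ?tk; last exact: mulgC.
    rewrite pair_half_is_half //; over.
    rewrite mulKg mulrC; over.
  rewrite [X in X == 0]addrC.
  rewrite -(bigID (fun g => pair_half k (g ^+ 2)%g) predT) /=.
  have := congr1 (fun y => gcoef y t^-1%g) xx.
  rewrite gcoefM gcoef1 eq_invg1 => e.
  rewrite (_ : t == 1%g = false) in e; last first.
    by apply: contraNF k1 => /eqP t1; rewrite -tk t1 expg1n.
  rewrite -[X in _ == X]e; apply/eqP; apply: eq_bigr => g _.
  by rewrite gcoef_conj invgM !invgK.
rewrite /f (exchange_big_dep (fun g => pair_half k (g ^+ 2)%g)) //=.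
rewrite [RHS](partition_big (fun g => g ^+ 2)%g (pair_half k)) //=.
apply: eq_bigr => h hh; rewrite mulr_suml.
apply: eq_big => [g|g /eqP gh]; first by case: eqP => [->|]; rewrite ?hh ?andbF.
rewrite mulr_sumr (reindex_inj (mulIg g)) /=; apply: eq_bigl => t.
rewrite expgMn; last exact: mulgC.
by rewrite gh hh andbT (inj_eq (mulIg _)).
Qed.
End PairForm.

(** * Unitary elements and coboundaries *)

Section Unitaries.
Variables (F : finFieldType) (G : finGroupType) (cG : abelian [set: G]).
Variable p : nat.
Hypotheses (pcharF : p \in [pchar F]) (pG : (p.-group [set: G])%g).
Local Notation A := (abgalg F cG).
Local Notation "x ^!" := (conj x) (at level 1, format "x ^!").
Implicit Types (x y z u v : A) (g h k : G) (K L : {group G}).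

Definition normalized K : {set A} := [set y in supported K | aug y == 1].
Definition unitaries K : {set A} := [set x in normalized K | x * x^! == 1].
(** The quotients $y / y^!$ are the coboundaries of the group of order two that
    acts by the involution. The factor from $K$ is needed when $p = 2$: an
    element of $K$ that is not a square is unitary but no such quotient. For odd
    $p$ it does not enlarge the group. *)
Definition coboundaries K : {set A} :=
  [set mon F cG k * (y / y^!) | k in K, y in normalized K].

Lemma normalizedP K y :
  reflect (y \in supported K /\ aug y = 1) (y \in normalized K).
Proof. by rewrite in_set; apply: (iffP andP) => -[? /eqP]. Qed.

Lemma normalizedM K : {in normalized K &, forall x y, x * y \in normalized K}.
Proof.
move=> x y /normalizedP[sx ax] /normalizedP[sy ay]; apply/normalizedP.
by rewrite rpredM // rmorphM /= ax ay mulr1.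
Qed.

Lemma normalized_invertible K y : y \in normalized K -> y \is a GRing.unit.
Proof. by case/normalizedP => _ /(unit_aug1 pcharF pG). Qed.

Lemma normalizedV K : {in normalized K, forall y, y^-1 \in normalized K}.
Proof.
move=> y /normalizedP[sy ay]; apply/normalizedP.
by rewrite (supported_inv pcharF pG) ?(aug_inv pcharF pG).
Qed.

Lemma normalized_conj K : {in normalized K, forall y, y^! \in normalized K}.
Proof.
move=> y /normalizedP[sy ay]; apply/normalizedP.
by rewrite aug_conj supported_conj.
Qed.

Lemma normalized_mon K k : k \in K -> mon F cG k \in normalized K.
Proof. by move=> Kk; apply/normalizedP; rewrite mem_supported_mon aug_mon. Qed.

Lemma normalized1 K : 1 \in normalized K.
Proof. exact: (normalized_mon (group1 K)). Qed.

Lemma unitariesP K x :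
  reflect (x \in normalized K /\ x * x^! = 1) (x \in unitaries K).
Proof. by rewrite [x \in unitaries K]in_set; apply: (iffP andP) => -[? /eqP]. Qed.

Lemma unitary_conj K x : x \in unitaries K -> x^! = x^-1.
Proof.
case/unitariesP => /normalized_invertible Ux xx.
by apply: (mulrI Ux); rewrite xx divrr.
Qed.

Lemma unitariesM K : {in unitaries K &, forall x y, x * y \in unitaries K}.
Proof.
move=> x y /unitariesP[nx xx] /unitariesP[ny yy]; apply/unitariesP.
split; first exact: normalizedM.
by rewrite rmorphM /= mulrACA xx yy mulr1.
Qed.

Lemma unitariesV K : {in unitaries K, forall x, x^-1 \in unitaries K}.
Proof.
move=> x Kx; rewrite -(unitary_conj Kx).
case/unitariesP: Kx => nx xx; apply/unitariesP.
by rewrite conjK mulrC normalized_conj.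
Qed.

Lemma unitaries_mon K k : k \in K -> mon F cG k \in unitaries K.
Proof.
move=> Kk; apply/unitariesP; rewrite normalized_mon //.
by rewrite conj_mon -monM mulgV.
Qed.

Lemma unitariesX K n : {in unitaries K, forall x, x ^+ n \in unitaries K}.
Proof.
move=> x Kx; elim: n => [|n IHn]; last by rewrite exprS unitariesM.
by rewrite expr0 -(mon1 F cG) unitaries_mon ?group1.
Qed.

Lemma unitaries_coboundary K y : y \in normalized K -> y / y^! \in unitaries K.
Proof.
move=> ny; have nyc := normalized_conj ny; apply/unitariesP.
rewrite normalizedM ?normalizedV //; split=> //.
rewrite rmorphM rmorphV ?normalized_invertible //= ?(normalized_invertible nyc) //.
by rewrite conjK mulrA divrK ?divrr ?(normalized_invertible ny) ?(normalized_invertible nyc).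
Qed.

Lemma coboundariesP K u :
  reflect (exists k y, [/\ k \in K, y \in normalized K &
             u = mon F cG k * (y / y^!)]) (u \in coboundaries K).
Proof.
apply: (iffP imset2P) => [[k y Kk ny ->] | [k [y [Kk ny ->]]]].
  by exists k, y.
by exists k y.
Qed.

Lemma coboundaries_unitary K : coboundaries K \subset unitaries K.
Proof.
apply/subsetP => u /coboundariesP[k [y [Kk ny ->]]].
by rewrite unitariesM ?unitaries_mon ?unitaries_coboundary.
Qed.

Lemma coboundary_mem K y : y \in normalized K -> y / y^! \in coboundaries K.
Proof. by move=> ny; apply/coboundariesP; exists 1%g, y; rewrite mon1 mul1r group1. Qed.

Lemma coboundaries_mon K k : k \in K -> mon F cG k \in coboundaries K.
Proof.
move=> Kk; apply/coboundariesP; exists k, 1.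
by rewrite normalized1 rmorph1 divr1 mulr1.
Qed.

Lemma coboundariesM K : {in coboundaries K &, forall x y, x * y \in coboundaries K}.
Proof.
move=> _ _ /coboundariesP[k [x [Kk nx ->]]] /coboundariesP[h [y [Kh ny ->]]].
have Uc z : z \in normalized K -> z^! \is a GRing.unit.
  by move/normalized_conj/normalized_invertible.
apply/coboundariesP; exists (k * h)%g, (x * y); split.
- exact: groupM.
- exact: normalizedM.
by rewrite monM rmorphM invrM ?Uc // mulrACA [y^!^-1 * _]mulrC [x / _ * _]mulrACA.
Qed.

Lemma normalized_exprp K y : y \in normalized K -> y ^+ p \in normalized 'Mho^1(K)%G.
Proof.
case/normalizedP => sy ay; apply/normalizedP.
by rewrite (supported_exprp pcharF pG) // rmorphXn /= ay expr1n.
Qed.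

Lemma normalized_exprp_surj K z : z \in normalized 'Mho^1(K)%G ->
  exists2 y, y \in normalized K & y ^+ p = z.
Proof.
case/normalizedP => /(exprp_surj pcharF pG)[y sy yz] az; exists y => //.
apply/normalizedP; split=> //.
have: aug y ^+ p = 1 ^+ p by rewrite expr1n -rmorphXn /= yz.
by rewrite -!(pFrobenius_autE pcharF) => /fmorph_inj.
Qed.

(** Frobenius commutes with the involution and is onto on both factors. *)
Lemma coboundaries_exprp K :
  [set u ^+ p | u in coboundaries K] = coboundaries 'Mho^1(K)%G.
Proof.
apply/setP => v; apply/imsetP/coboundariesP.
  case=> u /coboundariesP[k [y [Kk ny ->]]] ->.
  exists (k ^+ p)%g, (y ^+ p); split; last 1 first.
  - by rewrite exprMn monX expr_div_n rmorphXn.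
  - by apply/(Mho1P cG pG); exists k.
  exact: normalized_exprp.
case=> k [z [Kk /normalized_exprp_surj[y ny <-] ->]].
case/(Mho1P cG pG): Kk => g Kg ->.
exists (mon F cG g * (y / y^!)); first by apply/coboundariesP; exists g, y.
by rewrite exprMn monX expr_div_n rmorphXn.
Qed.

(** Hilbert 90: $y = 1 + x$ satisfies $x y^! = y$, and its augmentation $2$ is
    invertible. *)
Lemma unitaries_odd K : odd p -> unitaries K = coboundaries K.
Proof.
move=> op; apply/eqP; rewrite eqEsubset coboundaries_unitary andbT.
apply/subsetP => x /unitariesP[nx xx]; apply/coboundariesP.
have n2 : (2%:R : F) != 0.
  rewrite -(dvdn_pcharf pcharF) dvdn_prime2 ?(pcharf_prime pcharF) //.
  by apply: contraTneq op => ->.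
pose y := 2%:R^-1 *: (1 + x).
have ny : y \in normalized K.
  case/normalizedP: nx => sx ax; apply/normalizedP.
  by rewrite rpredZ ?rpredD ?rpred1 // augZ rmorphD rmorph1 /= ax mulVf.
exists 1%g, y; rewrite group1 ny mon1 mul1r; split=> //.
have Uy := normalized_invertible (normalized_conj ny).
apply: (mulIr Uy); rewrite divrK // conjZ rmorphD rmorph1 /= -scalerAr mulrDr.
by rewrite xx mulr1 addrC.
Qed.
End Unitaries.

(** * Squares of unitary elements in characteristic two *)

Lemma card_uniform_fibers (T T' : finType) (f : T -> T') (D : {set T}) (n : nat) :
    {in D, forall x, #|[set y in D | f y == f x]| = n} ->
  #|D| = (#|f @: D| * n)%N.
Proof.
move=> Dn; rewrite -sum1_card (partition_big_imset f) /= -sum_nat_const.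
apply: eq_bigr => _ /imsetP[x Dx ->]; rewrite -(Dn x Dx) -sum1_card.
by apply: eq_bigl => y; rewrite inE.
Qed.

Section CharTwo.
Variables (F : finFieldType) (G : finGroupType) (cG : abelian [set: G]).
Hypotheses (ch2 : 2%N \in [pchar F]) (pG : (2.-group [set: G])%g).
Local Notation A := (abgalg F cG).
Local Notation "x ^!" := (conj x) (at level 1, format "x ^!").
Local Notation normalized := (normalized F cG).
Local Notation unitaries := (unitaries F cG).
Local Notation coboundaries := (coboundaries F cG).
Implicit Types (x y z u v w r c e : A) (g h k t : G) (K L M : {group G}).

Let mulgC : commutative (@mulg G).
Proof. by move=> g h; apply: (centsP cG); rewrite inE. Qed.

Let ch2A : 2%N \in [pchar A]. Proof. exact: (pchar_abgalg cG ch2). Qed.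
Let two0 : 2%:R = 0 :> A. Proof. exact: pcharf0 ch2A. Qed.
Let addAA x : x + x = 0. Proof. exact: addrr_pchar2. Qed.
Let sqrD x y : (x + y) ^+ 2 = x ^+ 2 + y ^+ 2.
Proof. by ring: two0. Qed.
Let eq_of_add0 x y : x + y = 0 -> x = y.
Proof. by move/eqP; rewrite addr_eq0 oppr_pchar2 // => /eqP. Qed.

Lemma conj_trace r : (r + r^!)^! = r + r^!.
Proof. by rewrite rmorphD /= conjK addrC. Qed.

(** The set of elements with such a decomposition contains the monomials and is
    closed under addition, because the cross terms $a b^! + b a^!$ are a
    trace. *)
Lemma norm_trace K y : y \in supported K ->
  exists2 u, u \in supported K & y * y^! = (aug y ^+ 2)%:A + (u + u^!).
Proof.
move/supported_expand->.
pose Q x := x \in supported K /\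
  exists2 u, u \in supported K & x * x^! = (aug x ^+ 2)%:A + (u + u^!).
suff: Q (\sum_(g in K) gcoef y g *: mon F cG g) by case.
apply: (big_ind Q) => [|a b [sa [u su ua]] [sb [v sv vb]]|g Kg].
- split; first exact: rpred0.
  by exists 0; rewrite ?rpred0 // mul0r !rmorph0 expr0n scale0r !addr0.
- split; first exact: rpredD.
  exists (u + v + a * b^!); first by rewrite !rpredD ?rpredM ?supported_conj.
  rewrite !rmorphD /= !rmorphM /= conjK.
  have -> : (aug a + aug b) ^+ 2 = aug a ^+ 2 + aug b ^+ 2.
    by rewrite -!(pFrobenius_autE ch2) rmorphD.
  rewrite scalerDl mulrDl !mulrDr ua vb; ring.
have sg : mon F cG g \in supported K by rewrite mem_supported_mon.
split; first by rewrite rpredZ.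
exists 0; first exact: rpred0.
rewrite conjZ conj_mon -scalerAl -scalerAr -monM mulgV mon1 augZ aug_mon.
by rewrite rmorph0 !addr0 mulr1 scalerA.
Qed.

Definition restrict (P : pred G) x : A := \sum_(g | P g) gcoef x g *: mon F cG g.

Lemma gcoef_restrict P x g : gcoef (restrict P x) g = if P g then gcoef x g else 0.
Proof.
rewrite gcoef_sum big_mkcond (bigD1 g) //= big1 => [|h nhg].
  by rewrite gcoefZ gcoef_mon eqxx mulr1 addr0.
by rewrite gcoefZ gcoef_mon (negPf nhg) mulr0 if_same.
Qed.

Lemma supported_restrict K P x : x \in supported K -> restrict P x \in supported K.
Proof.
move/supportedP=> sx; apply/supportedP => g ng.
by rewrite gcoef_restrict sx ?if_same.
Qed.

Lemma restrictC P x : x = restrict P x + restrict (predC P) x.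
Proof.
apply: gcoefP => g; rewrite gcoefD !gcoef_restrict /=.
by case: (P g); rewrite ?addr0 ?add0r.
Qed.

Lemma symmetric_trace K x : x \in supported K -> x^! = x ->
    (forall g, (g ^+ 2 = 1)%g -> gcoef x g = 0) ->
  exists2 r, r \in supported K & x = r + r^!.
Proof.
move=> sx xx x0; exists (restrict (rank_half invg) x).
  exact: supported_restrict.
apply: gcoefP => g; rewrite gcoefD gcoef_conj !gcoef_restrict.
have xV : gcoef x g^-1%g = gcoef x g by rewrite -gcoef_conj xx.
have [g2|ng2] := eqVneq (g ^+ 2)%g 1%g.
  by rewrite xV x0 // !if_same addr0.
rewrite rank_halfP; [|exact: invgK|by rewrite eq_invg_mul -expg2].
by rewrite xV; case: rank_half; rewrite ?addr0 ?add0r.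
Qed.

Lemma unit_aug x : aug x != 0 -> x \is a GRing.unit.
Proof.
move=> ax; pose b := (aug x)^-1.
have: aug (b *: x) = 1 by rewrite augZ mulVf.
move/(unit_aug1 ch2 pG) => Ub.
have <- : (aug x)%:A * (b *: x) = x by rewrite -scalerAl mul1r scalerA mulfV ?scale1r.
by rewrite unitrM Ub andbT scaler_unit ?unitr1 // unitfE.
Qed.

(** It suffices to treat, for a given $t \notin L$, a subgroup $M$ that contains
    $L$ and is maximal without $t$, because $M$ and $t M$ then cover all
    elements of order at most two. Split $x = u + t v$ accordingly. For $k$ in
    $t M$ the set $M$ meets each pair $\{g, kg\}$ once, so the vanishing of the
    form at $k$ says that the coefficient of $u v$ at $t k$ is $0$. Hence
    $u v = 0$, while the augmentations of $u$ and $v$ add up to $1$; one of them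
    is a unit, and the other one is $0$. *)
Lemma support_coset L x : aug x = 1 ->
    (forall g, (g ^+ 2 != 1)%g -> gcoef x g = 0) ->
    (forall k, (k ^+ 2 = 1)%g -> k \notin L -> pair_form k x = 0) ->
  forall g g', gcoef x g != 0 -> gcoef x g' != 0 -> (g' * g^-1)%g \in L.
Proof.
move=> ax x0 Q0 g0 g1 ng0 ng1; apply: contraTT isT => nLt /=.
have [t tE] : exists t, t = (g1 * g0^-1)%g by exists (g1 * g0^-1)%g.
rewrite -tE in nLt.
have sq1 g : gcoef x g != 0 -> (g ^+ 2 = 1)%g.
  by move=> ng; apply/eqP; apply: contraNT ng => /x0/eqP.
have t2 : (t ^+ 2 = 1)%g.
  by rewrite tE expgMn ?expVgn ?sq1 ?invg1 ?mulg1.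
have tt : (t * t = 1)%g by rewrite -expg2.
have [M /maxgroupP[/andP[sLM nMt] maxM] _] :
    {M : {group G} | ([max M | (L \subset M) && (t \notin M)])%g & L \subset M}.
  by apply: maxgroup_exists; rewrite subxx.
(* By maximality t lies in the subgroup generated by M and g, which is the
   union of M and M g. *)
have coM g : (g ^+ 2 = 1)%g -> g \notin M -> (t * g)%g \in M.
  move=> g2 nMg; have: t \in (M <*> <[g]>)%g.
    apply: contraR nMg => ntj.
    rewrite -(maxM (M <*> <[g]>)%G) ?joing_subl //; last first.
      by rewrite (subset_trans sLM) ?joing_subl.
    by rewrite (subsetP (joing_subr _ _)) ?cycle_id.
  rewrite cent_joinEr; last first.
    by apply: subset_trans (subsetT _) (subset_trans cG (centS (subsetT _))).
  case/mulsgP => m h Mm /cycleP[i ->] def_t; rewrite def_t.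
  have gi : (g ^+ i = 1 \/ g ^+ i = g)%g.
    by rewrite -(expg_mod i g2); case: (i %% 2)%N (ltn_pmod i (isT : 0 < 2)%N) => [|[|//]]; [left | right].
  case: gi def_t => ->; first by rewrite mulg1 => tm; rewrite tm Mm in nMt.
  by rewrite -mulgA -expg2 g2 mulg1.
pose M' : pred G := fun g => g \in M.
pose u := restrict M' x; pose v := mon F cG t * restrict (predC M') x.
have uv : u * v = 0.
  apply: gcoefP => h; rewrite gcoefM gcoef0.
  under eq_bigr => g _ do rewrite gcoef_monM !gcoef_restrict /= /M'.
  have tV : (t^-1 = t)%g by apply/eqP; rewrite eq_invg_mul tt.
  have [Mh|nMh] := boolP (h \in M); last first.
    apply: big1 => g _; case: ifP => [Mg|]; last by rewrite mul0r.
    have [//|] := boolP (t^-1 * (g^-1 * h) \in M)%g; rewrite ?mulr0 // => nM'.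
    have [/eqP->|/sq1 th2] := boolP (gcoef x (t^-1 * (g^-1 * h))%g == 0); first by rewrite mulr0.
    by have := coM _ th2 nM'; rewrite mulKVg groupMl ?groupV // (negPf nMh).
  have nMk : (t * h)%g \notin M by rewrite groupMr.
  have [h2|nh2] := eqVneq (h ^+ 2)%g 1%g; last first.
    apply: big1 => g _; case: ifP => [Mg|]; last by rewrite mul0r.
    case: ifP => _; last by rewrite mulr0.
    have [/eqP->|/sq1 g2] := boolP (gcoef x g == 0); first by rewrite mul0r.
    rewrite (x0 (t^-1 * (g^-1 * h))%g) ?mulr0 //; apply: contraNneq nh2.
    by rewrite !expgMn // !expVgn t2 g2 !invg1 !mul1g => ->.
  have k2 : ((t * h) ^+ 2 = 1)%g by rewrite expgMn // t2 h2 mulg1.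
  have k1 : (t * h)%g != 1%g by apply: contraNneq nMk => ->.
  have nLk : (t * h)%g \notin L by apply: contra nMk => /(subsetP sLM).
  (* Outside M and t M, where x vanishes, any choice of representatives does. *)
  pose T g := if (g \in M) || ((t * g)%g \in M) then g \in M else pair_half (t * h)%g g.
  have kT : is_half (mulg (t * h)%g) T.
    move=> g; rewrite /T; have -> : (t * h * g \in M)%g = (t * g \in M)%g.
      by rewrite [(t * h)%g]mulgC -mulgA (groupMl _ Mh).
    have -> : (t * (t * h * g) \in M)%g = (g \in M).
      by rewrite !mulgA tt mul1g (groupMl _ Mh).
    rewrite orbC; case: ifP => [|_]; last exact: pair_half_is_half.
    case Mg: (g \in M); first by rewrite groupMr ?(negPf nMt).
    by move=> /orP[|->].
  transitivity (pair_form (t * h)%g x); last exact: Q0.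
  rewrite (pair_formE x k2 k1 kT).
  rewrite [RHS]big_mkcond /=; apply: eq_bigr => g _.
  have [/eqP xg|/sq1 g2] := boolP (gcoef x g == 0).
    by rewrite xg !mul0r !if_same mul0r.
  have gV : (g^-1 = g)%g by apply/eqP; rewrite eq_invg_mul -expg2 g2.
  have -> : (t^-1 * (g^-1 * h) = t * h * g)%g by rewrite tV gV [(g * h)%g]mulgC mulgA.
  rewrite /T; case Mg: (g \in M) => /=; last first.
    by rewrite coM ?Mg // mul0r.
  by rewrite groupMr // (negPf nMk).
have mt2 : mon F cG t * mon F cG t = 1 by rewrite -monM tt.
have xuv : x = u + mon F cG t * v by rewrite mulrA mt2 mul1r -restrictC.
have Mg01 : (g0 \in M) = (g1 \in M).
  have auv : aug u + aug v = 1.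
    by rewrite -ax xuv rmorphD rmorphM /= aug_mon mul1r.
  have [au0|nau] := eqVneq (aug u) 0.
    have Uv : v \is a GRing.unit by rewrite unit_aug // -[aug v]add0r -[X in X + _]au0 auv oner_eq0.
    have u0 : u = 0 by apply: (mulIr Uv); rewrite uv mul0r.
    have nM g : gcoef x g != 0 -> g \notin M.
      apply: contraNN => Mg; have := gcoef_restrict M' x g.
      by rewrite -/u u0 gcoef0 /M' Mg => <-.
    by rewrite !(negPf (nM _ _)).
  have Uu := unit_aug nau.
  have v0 : v = 0 by apply: (mulrI Uu); rewrite uv mulr0.
  have xu : x = u by rewrite xuv v0 mulr0 addr0.
  have inM g : gcoef x g != 0 -> g \in M.
    by rewrite xu gcoef_restrict /M'; case: ifP; rewrite ?eqxx.
  by rewrite !inM.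
case Mg0: (g0 \in M).
  by move: nMt; rewrite tE groupM ?groupV -?Mg01.
have := coM _ (sq1 _ ng0); rewrite Mg0 => /(_ isT).
by rewrite tE mulgKV -Mg01 Mg0.
Qed.

(** This is the kernel of the map from $FK$ to the group algebra of the quotient
    of $K$ by its elements of order at most two. *)
Definition sqr0 K : {set A} := [set v in supported K | v ^+ 2 == 0].

Lemma sqr0P K v : reflect (v \in supported K /\ v ^+ 2 = 0) (v \in sqr0 K).
Proof. by rewrite in_set; apply: (iffP andP) => -[? /eqP]. Qed.

Lemma sqr0D K : {in sqr0 K &, forall v w, v + w \in sqr0 K}.
Proof.
move=> v w /sqr0P[sv v2] /sqr0P[sw w2]; apply/sqr0P.
by rewrite rpredD // sqrD v2 w2 addr0.
Qed.

Lemma sqr0_0 K : 0 \in sqr0 K.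
Proof. by apply/sqr0P; rewrite rpred0 expr0n. Qed.

Lemma sqr0M K v w : v \in sqr0 K -> w \in supported K -> v * w \in sqr0 K.
Proof.
move=> /sqr0P[sv v2] sw; apply/sqr0P.
by rewrite rpredM // exprMn v2 mul0r.
Qed.

(** The kernel is spanned by the elements $g + h$ with $g^2 = h^2$. Their norm is
    $2 + g h^{-1} + h g^{-1} = 0$, since $g h^{-1}$ is its own inverse, and the
    cross terms of a sum are traces. *)
Lemma sqr0_norm K v : v \in sqr0 K ->
  exists2 u, u \in sqr0 K & v * v^! = u + u^!.
Proof.
case/sqr0P => sv v2.
(* A representative of the fibre of g under squaring. *)
pose tau g := odflt 1%g [pick h in K | (h ^+ 2 == g ^+ 2)%g].
have tauP g : g \in K -> tau g \in K /\ (tau g ^+ 2 = g ^+ 2)%g.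
  move=> Kg; rewrite /tau; case: pickP => [h /andP[Kh /eqP] | /(_ g)] //.
  by rewrite Kg eqxx.
have -> : v = \sum_(g in K) gcoef v g *: (mon F cG g + mon F cG (tau g)).
  rewrite {1}(supported_expand sv) -[LHS]addr0.
  under [RHS]eq_bigr => g _ do rewrite scalerDr.
  rewrite big_split /=; congr (_ + _); apply/esym.
  pose sg g := (g ^+ 2)%g.
  rewrite (partition_big sg predT) //= big1 // => k _.
  have [g /andP[Kg /eqP gk] | no] := pickP (fun g => (g \in K) && (sg g == k));
    last exact: big_pred0.
  rewrite (eq_bigr (fun h => gcoef v h *: mon F cG (tau g))); last first.
    by move=> h /andP[_ /eqP hk]; rewrite /tau [(h ^+ 2)%g]hk -gk.
  rewrite -scaler_suml [X in X *: _](_ : _ = 0) ?scale0r //.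
  have := congr1 (fun y => gcoef y k) v2; rewrite (gcoef_exprp ch2) gcoef0.
  move/eqP; rewrite expf_eq0 /= => /eqP e; rewrite -[RHS]e.
  rewrite [RHS](bigID (mem K)) /= [X in _ = _ + X]big1 ?addr0 => [|h /andP[_]].
    by apply: eq_bigl => h; rewrite andbC.
  exact: (supportedP _ _ sv).
set E := BIG_F.
pose Q x := x \in sqr0 K /\ exists2 u, u \in sqr0 K & x * x^! = u + u^!.
suff: Q (\sum_(g in K) E g) by case.
apply: (big_ind Q) => [|a b [sa [u su ua]] [sb [w sw wb]]|g Kg].
- split; first exact: sqr0_0.
  by exists 0; rewrite ?sqr0_0 // mul0r rmorph0 addr0.
- split; first exact: sqr0D.
  exists (u + w + a * b^!).
    by rewrite !sqr0D // sqr0M // supported_conj //; case/sqr0P: sb.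
  rewrite !rmorphD /= rmorphM /= conjK mulrDl !mulrDr ua wb; ring.
have [Kt t2] := tauP g Kg.
split.
  apply/sqr0P; rewrite rpredZ ?rpredD ?mem_supported_mon //; split=> //.
  by rewrite /E exprZn sqrD -!monX t2 addAA scaler0.
exists 0; first exact: sqr0_0.
rewrite rmorph0 addr0 /E conjZ -scalerAl -scalerAr rmorphD /= !conj_mon.
rewrite mulrDl !mulrDr -!monM !mulgV.
have -> : (tau g * g^-1 = g * (tau g)^-1)%g.
  apply: (mulgI (tau g)); apply: (mulIg g); rewrite mulgA mulgKV -expg2 t2.
  by rewrite [(g * _)%g]mulgC mulKVg.
have -> : forall y z, y + z + (z + y) = 0 by move=> y z; ring: two0.
by rewrite !scaler0.
Qed.

Lemma trace_eq x y : x + x^! = y + y^! <-> (x + y)^! = x + y.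
Proof.
rewrite rmorphD /=; split=> h; apply: eq_of_add0.
  have: (x + x^!) + (y + y^!) = 0 by rewrite h addAA.
  by move=> <-; ring.
have: (x^! + y^!) + (x + y) = 0 by rewrite h addAA.
by move=> <-; ring.
Qed.

Lemma sqr1D v : v ^+ 2 = 0 -> (1 + v) ^+ 2 = 1.
Proof. by move=> v2; rewrite sqrD v2 expr1n addr0. Qed.

(** The norm $1 + e \mapsto (1 + e)(1 + e)^!$ is a homomorphism for
    multiplication, the trace $w \mapsto w + w^!$ one for addition, and the
    symmetric $e$ describe the kernels of both, since $1 + e$ is its own inverse.
    So their images have the same size, and by [sqr0_norm] the first one lies in
    the second one shifted by $1$. *)
Lemma sqr0_norm_surj K v : v \in sqr0 K ->
  exists2 e, e \in sqr0 K & (1 + e) * (1 + e)^! = 1 + (v + v^!).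
Proof.
pose D := sqr0 K; pose S := [set s in D | s^! == s].
pose phi e := (1 + e) * (1 + e)^!; pose psi w := 1 + (w + w^!).
have SP s : reflect (s \in D /\ s^! = s) (s \in S).
  by rewrite [s \in S]in_set; apply: (iffP andP) => -[? /eqP].
have psiD : #|D| = (#|psi @: D| * #|S|)%N.
  apply: card_uniform_fibers => x Dx.
  rewrite -(card_imset (mem S) (addrI x)); apply: eq_card => y.
  rewrite in_set; apply/andP/imsetP.
    case=> Dy /eqP/addrI/trace_eq xy; exists (x + y); last by rewrite addrA addAA add0r.
    by apply/SP; split; [exact: sqr0D | rewrite addrC xy].
  case=> s /SP[Ds ss] ->; split; first exact: sqr0D.
  by apply/eqP; congr (1 + _); apply/trace_eq; rewrite [x + s]addrC -addrA addAA addr0.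
have phiD : #|D| = (#|phi @: D| * #|S|)%N.
  apply: card_uniform_fibers => x Dx.
  have x2 : x ^+ 2 = 0 by case/sqr0P: Dx.
  (* Translation by 1 + x in the multiplicative group. *)
  pose m s := x + s + x * s.
  have mK : involutive m by move=> s; rewrite /m; ring: two0 x2.
  have mE s : 1 + m s = (1 + x) * (1 + s) by rewrite /m; ring.
  have mD s : s \in D -> m s \in D.
    move=> Ds; rewrite /m !sqr0D // sqr0M //; by case/sqr0P: Ds.
  have X2 := sqr1D x2.
  have X2' : ((1 + x)^!) ^+ 2 = 1 by rewrite -rmorphXn /= X2 rmorph1.
  rewrite -(card_imset (mem S) (inv_inj mK)); apply: eq_card => y.
  rewrite in_set; apply/andP/imsetP.
    case=> Dy /eqP xy; exists (m y); last by rewrite mK.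
    apply/SP; split; [exact: mD | apply: (addrI 1)].
    have Y2 : (1 + y) ^+ 2 = 1 by apply: sqr1D; case/sqr0P: Dy.
    rewrite -{1}[1](rmorph1 (@conj F G cG)) -rmorphD mE rmorphM /=.
    transitivity ((1 + y) * (1 + x)^! * phi y).
      rewrite /phi -[LHS]mul1r -[X in X * _ = _]Y2; ring.
    by rewrite xy /phi -[RHS]mul1r -[X in _ = X * _]X2'; ring.
  case=> s /SP[Ds ss] ->; split; first exact: mD.
  have S2 : (1 + s) ^+ 2 = 1 by apply: sqr1D; case/sqr0P: Ds.
  apply/eqP; rewrite /phi mE rmorphM /= [(1 + s)^!]rmorphD rmorph1 /= ss.
  by rewrite -[RHS]mulr1 -[X in _ = _ * X]S2; ring.
have sub : phi @: D \subset psi @: D.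
  apply/subsetP => _ /imsetP[e De ->].
  have [u Du ue] := sqr0_norm De.
  apply/imsetP; exists (e + u); first exact: sqr0D.
  rewrite /phi /psi !rmorphD rmorph1 /= mulrDl !mulrDr ue; ring.
have eqD : phi @: D = psi @: D.
  apply/eqP; rewrite eqEcard sub /=.
  have S0 : (0 < #|S|)%N.
    by apply/card_gt0P; exists 0; apply/SP; rewrite rmorph0; split=> //; exact: sqr0_0.
  by rewrite -(leq_pmul2r S0) -psiD -phiD.
move=> Dv; have : psi v \in phi @: D by rewrite eqD imset_f.
by case/imsetP => e De pe; exists e => //; rewrite -[RHS]/(psi v) pe.
Qed.

(** The forms say that $r^2$ has coefficient $0$ at the involutions, and $c^2 = 1$
    makes $r^2$ symmetric. So $r^2 = e^2$ for a symmetric $e$, and $r + e$ has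
    square $0$ and the same trace as $r$. *)
Lemma coboundary_of_pair_form K c r : r \in supported K ->
    c = 1 + (r + r^!) -> c ^+ 2 = 1 ->
    (forall k, (k ^+ 2 = 1)%g -> k != 1%g -> pair_form k c = 0) ->
  exists2 y, y \in normalized K & c = y / y^!.
Proof.
move=> sr cE c2 Q0.
have rho0 k : (k ^+ 2 = 1)%g -> k != 1%g -> gcoef (r ^+ 2) k = 0.
  move=> k2 k1; have := Q0 k k2 k1; rewrite cE pair_form_decomp //; last first.
    move=> g ng; by rewrite gcoef1; case: (eqVneq g 1%g) ng => // ->; rewrite expg1n eqxx.
  rewrite (gcoef_exprp ch2) [pair_form _ _]big1 ?add0r // => g _.
  rewrite !gcoef1; case: eqP => [->|]; last by rewrite mul0r.
  by rewrite mulg1 (negPf k1) mulr0.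
have r2s : (r ^+ 2)^! = r ^+ 2.
  apply: eq_of_add0; rewrite rmorphXn /= -sqrD addrC.
  apply: (addrI 1); rewrite addr0 -{1}[1](expr1n _ 2) -sqrD -cE; exact: c2.
have [q sq qE] : exists2 q, q \in supported 'Mho^1(K)%G &
    r ^+ 2 + (gcoef (r ^+ 2) 1%g)%:A = q + q^!.
  apply: symmetric_trace.
  - by rewrite rpredD ?rpredZ ?rpred1 // (supported_exprp ch2 pG).
  - by rewrite rmorphD /= r2s conjZ rmorph1.
  move=> g g2; rewrite gcoefD gcoefZ gcoef1.
  have [->|ng1] := eqVneq g 1%g; first by rewrite mulr1 addrr_pchar2.
  by rewrite rho0 // mulr0 addr0.
have [q1 sq1 q1E] := exprp_surj ch2 pG sq.
pose b := (\sum_(h | (h ^+ 2 == 1)%g) gcoef r h).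
have bE : gcoef (r ^+ 2) 1%g = b ^+ 2 by rewrite (gcoef_exprp ch2).
pose e := b%:A + (q1 + q1^!).
have es : e^! = e by rewrite rmorphD /= conj_trace conjZ rmorph1.
have e2 : e ^+ 2 = r ^+ 2.
  rewrite /e !sqrD -rmorphXn q1E -qE exprZn expr1n bE.
  by rewrite addrCA addAA addr0.
have se : e \in supported K.
  by rewrite /e !rpredD ?rpredZ ?rpred1 ?supported_conj.
have [f Df fE] : exists2 f, f \in sqr0 K & (1 + f) * (1 + f)^! = c.
  have Dre : r + e \in sqr0 K by apply/sqr0P; rewrite rpredD // sqrD e2 addAA.
  have [f Df fE] := sqr0_norm_surj Dre; exists f => //.
  rewrite fE cE; congr (1 + _); apply/trace_eq.
  by rewrite [r + e]addrC -addrA addAA addr0.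
have [sf f2] := sqr0P _ _ Df.
have af : aug f = 0 by apply/eqP; have := congr1 (@aug F G cG) f2;
  rewrite rmorphXn rmorph0 /= => /eqP; rewrite expf_eq0.
have nf : 1 + f \in normalized K.
  by apply/normalizedP; rewrite rpredD ?rpred1 // rmorphD rmorph1 /= af addr0.
exists (1 + f)^!; first exact: normalized_conj.
rewrite conjK -fE mulrC; congr (_ * _).
have Uf := normalized_invertible ch2 pG nf.
by apply: (mulIr Uf); rewrite mulVr // -expr2 sqr1D.
Qed.

Lemma trivial_normalized K x : K :=: 1%g -> x \in normalized K -> x = 1.
Proof.
move=> K1 /normalizedP[/supported_expand xE ax].
have {}xE : x = (gcoef x 1%g)%:A.
  by rewrite {1}xE (big_pred1 1%g) ?mon1 // => g; rewrite K1 inE.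
by move: ax; rewrite xE augZ rmorph1 mulr1 => ->; rewrite scale1r.
Qed.

(** The inductive step for $p = 2$. The part $e$ of $c = x^2$ on the elements of
    order at most two is moved into $F[K^4]$ by an involution $z \in K^2$, and
    there it is a square $y^2$ with $y \in F[K^2]$. Multiplying $c$ by
    $z y^! / y$, the square of a unitary element of $FK$, replaces $e$
    by $1$. *)
Lemma unitary_sqr_coboundary K x : x \in unitaries K -> x ^+ 4 = 1 ->
  x ^+ 2 \in coboundaries 'Mho^1(K)%G.
Proof.
set L := 'Mho^1(K)%G => Kx x4; pose c := x ^+ 2.
have [nx xx] := unitariesP _ _ Kx.
have nc : c \in normalized L by rewrite (normalized_exprp ch2 pG).
have [sc ac] := normalizedP _ _ nc.
have c2 : c ^+ 2 = 1 by rewrite -exprM.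
have Uc := normalized_invertible ch2 pG nc.
have cc : c^! = c.
  apply: (mulrI Uc); rewrite -expr2 c2 /c rmorphXn -exprMn xx expr1n //.
pose invol : pred G := fun g => (g ^+ 2 == 1)%g.
pose e := restrict invol c.
have e0 g : (g ^+ 2 != 1)%g -> gcoef e g = 0.
  by move=> ng; rewrite gcoef_restrict /invol (negPf ng).
have se : e \in supported L by apply: supported_restrict.
have ee : e^! = e.
  apply: gcoefP => g; rewrite gcoef_conj !gcoef_restrict /invol -gcoef_conj cc.
  by rewrite expgVn eq_invg1.
have [r sr cE] : exists2 r, r \in supported L & c + e = r + r^!.
  apply: symmetric_trace; [exact: rpredD | by rewrite rmorphD /= cc ee |].
  move=> g g2; rewrite gcoefD gcoef_restrict /invol g2 eqxx.
  exact: addrr_pchar2.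
have {}cE : c = e + (r + r^!) by rewrite -cE addrCA addAA addr0.
have ae : aug e = 1.
  move: ac; rewrite cE !rmorphD /= aug_conj => <-.
  by rewrite addrr_pchar2 // addr0.
have Qc k : (k ^+ 2 = 1)%g -> k != 1%g -> pair_form k c = 0.
  by move=> k2 k1; apply: pair_form_unitary_sqr.
have [z nz] : exists z : G, gcoef e z != 0.
  apply/existsP; apply: contraT; rewrite negb_exists => /forallP z0.
  move: ae; rewrite augE big1 => [/eqP|g _]; last by apply/eqP; rewrite -[_ == _]negbK z0.
  by rewrite eq_sym oner_eq0.
have z2 : (z ^+ 2 = 1)%g by apply/eqP; apply: contraNT nz => /e0->.
have Lz : z \in L by apply: contraNT nz => /(supportedP _ _ se)->.
pose e' := mon F cG z * e.
have se' : e' \in supported 'Mho^1(L)%G.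
  apply/supportedP => g ng; rewrite gcoef_monM; apply/eqP.
  apply: contraNT ng => ng.
  have -> : g = (z^-1 * g * z^-1)%g.
    by rewrite [(z^-1 * g)%g]mulgC -mulgA -expg2 expgVn z2 invg1 mulg1.
  apply: (support_coset ae e0) nz ng => k k2 nLk.
  have k1 : k != 1%g by apply: contraNneq nLk => ->; apply: group1.
  have := Qc k k2 k1; rewrite cE pair_form_decomp // [X in X ^+ 2]big1 ?expr0n ?addr0 //.
  move=> h /eqP hk; apply: (supportedP _ _ sr); apply: contraNN nLk => Lh.
  by apply/(Mho1P cG pG); exists h.
have ae' : aug e' = 1 by rewrite rmorphM /= aug_mon ae mulr1.
have zV : (z^-1 = z)%g by apply/eqP; rewrite eq_invg_mul -expg2 z2.
have mzc : (mon F cG z)^! = mon F cG z by rewrite conj_mon zV.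
have mz2 : mon F cG z ^+ 2 = 1 by rewrite -monX z2.
have e'c : e'^! = e' by rewrite rmorphM /= mzc ee.
have e'2 : e' ^+ 2 = 1.
  rewrite exprMn mz2 mul1r (exprp_expand ch2).
  transitivity ((aug e ^+ 2)%:A : A); last by rewrite ae expr1n scale1r.
  rewrite augE -(pFrobenius_autE ch2) rmorph_sum /= scaler_suml.
  apply: eq_bigr => g _; rewrite pFrobenius_autE.
  have [->|ng] := eqVneq (gcoef e g) 0; first by rewrite expr0n !scale0r.
  by have /eqP-> : (g ^+ 2 == 1)%g by apply: contraNT ng => /e0->.
have ne' : e' \in normalized 'Mho^1(L)%G by apply/normalizedP.
have [y ny ye] := normalized_exprp_surj ch2 pG ne'.
have [t nt ty] := normalized_exprp_surj ch2 pG ny.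
have [a Ka az] : exists2 a, a \in K & (a ^+ 2 = z)%g.
  by case/(Mho1P cG pG): Lz => a Ka ->; exists a.
(* The corrected c' is again the square of a unitary element, so the forms
   vanish at c' too. *)
pose x' := mon F cG a * x * (t / t^!)^-1.
pose c' := mon F cG z * c * (y / y^!)^-1.
have Kx' : x' \in unitaries K.
  apply: unitariesM; first by apply: unitariesM => //; apply: unitaries_mon.
  by apply: (unitariesV ch2 pG); apply: (unitaries_coboundary ch2 pG).
have x'c : x' ^+ 2 = c'.
  by rewrite !exprMn -monX az exprVn expr_div_n -rmorphXn /= ty.
have Uy := normalized_invertible ch2 pG ny.
have nyc := normalized_conj ny.
have Uyc := normalized_invertible ch2 pG nyc.
(* The inverse of y / y^! is its norm y y^! divided by y^2, and y^2 = e' is its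
   own inverse. *)
have yVc : (y / y^!)^-1 = y * y^! * e'.
  have yV : y^-1 = y * e' by apply: (mulrI Uy); rewrite divrr // mulrA -expr2 ye -expr2 e'2.
  by rewrite invrM ?unitrV // invrK yV; ring.
have [s ss sE] := norm_trace (proj1 (normalizedP _ _ ny)).
have ay : aug y = 1 by case/normalizedP: ny.
rewrite ay expr1n scale1r in sE.
pose r2 := e' * mon F cG z * r.
have sr2 : r2 \in supported L by rewrite !rpredM ?mem_supported_mon.
have r2E : e' * mon F cG z * (r + r^!) = r2 + r2^!.
  by rewrite /r2 mulrDr [X in _ + X^!]mulrC rmorphM [X in r^! * X]rmorphM /= e'c mzc [r^! * _]mulrC.
have c'E : c' = 1 + ((s + r2 + r2 * (s + s^!)) + (s + r2 + r2 * (s + s^!))^!).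
  transitivity ((e' ^+ 2 + e' * mon F cG z * (r + r^!)) * (1 + (s + s^!))).
    by rewrite /c' yVc [in LHS]cE sE /e'; ring.
  clearbody r2; rewrite e'2 r2E !rmorphD rmorphM rmorphD /= conjK; ring.
have c'2 : c' ^+ 2 = 1.
  rewrite /c' exprMn exprMn c2 mz2 !mul1r exprVn expr_div_n -rmorphXn /= ye e'c divrr ?invr1 //.
  by rewrite -ye unitrX.
have Lr : s + r2 + r2 * (s + s^!) \in supported L.
  apply: rpredD; first exact: rpredD.
  by apply: rpredM => //; apply: rpredD => //; apply: supported_conj.
have Q' k : (k ^+ 2 = 1)%g -> k != 1%g -> pair_form k c' = 0.
  move=> k2 k1; rewrite -x'c; apply: pair_form_unitary_sqr => //.
  by case/unitariesP: Kx'.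
have [w nw c'w] := coboundary_of_pair_form Lr c'E c'2 Q'.
have -> : x ^+ 2 = mon F cG z * (c' * (y / y^!)).
  rewrite /c' divrK ?mulrA -?expr2 ?mz2 ?mul1r //.
  by rewrite unitrM Uy unitrV.
apply: (coboundariesM ch2 pG); first exact: coboundaries_mon.
by rewrite c'w; apply: (coboundariesM ch2 pG); apply: coboundary_mem.
Qed.

(** By induction $x^4$ is the square of some element of $U(K^2)$, hence the fourth
    power of some $v \in U(K)$, and $x / v$ is covered by the preceding
    lemma. *)
Lemma unitaries_sqr K x : x \in unitaries K -> x ^+ 2 \in coboundaries 'Mho^1(K)%G.
Proof.
have [n] := ubnP #|K|; elim: n K x => // n IHn K x leKn Kx.
have [K1|ntK] := eqVneq (K : {set G}) 1%g.
  rewrite (trivial_normalized K1 (proj1 (unitariesP _ _ Kx))) expr1n.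
  by rewrite -(mon1 F cG) coboundaries_mon.
pose L := 'Mho^1(K)%G.
have [pK cK] : (2.-group K)%g /\ abelian K.
  by split; [exact: pgroupS (subsetT K) pG | exact: abelianS (subsetT K) cG].
have ltLK : (#|L| < #|K|)%N.
  by apply: proper_card; rewrite /= -(Phi_Mho pK cK) Phi_proper.
have Lx2 : x ^+ 2 \in unitaries L.
  have [nx xx] := unitariesP _ _ Kx; apply/unitariesP.
  by rewrite (normalized_exprp ch2 pG) // rmorphXn -exprMn xx expr1n.
have := IHn L _ (leq_trans ltLK leKn) Lx2.
rewrite -(coboundaries_exprp cG ch2 pG) => /imsetP[u].
rewrite -{1}(coboundaries_exprp cG ch2 pG) => /imsetP[v Kv ->] x4.
have Kv' := subsetP (coboundaries_unitary cG ch2 pG K) _ Kv.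
have Uv : v \is a GRing.unit by case/unitariesP: Kv' => /(normalized_invertible ch2 pG).
have -> : x ^+ 2 = (x / v) ^+ 2 * v ^+ 2 by rewrite expr_div_n divrK ?unitrX.
apply: (coboundariesM ch2 pG); last first.
  by rewrite -(coboundaries_exprp cG ch2 pG); apply: imset_f.
apply: unitary_sqr_coboundary.
  by apply: unitariesM => //; apply: (unitariesV ch2 pG).
by rewrite expr_div_n -[4%N]/(2 * 2)%N exprM x4 -exprM divrr ?unitrX.
Qed.
End CharTwo.

(** * Functoriality in the group *)

Section Map.
Variables (F : fieldType) (G H : groupType) (f : G -> H).
Implicit Types x y : galg F G.

(** The map $f$ is an arbitrary function, multiplicative or injective only on the
    supports at hand: this covers isomorphisms of groups as well as morphisms
    defined on a subgroup. *)
Definition galg_map x : galg F H := \sum_(g <- msupp x) << x@_g *g f g >>.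

Lemma galg_mapEw (d : {fset G}) x : (msupp x `<=` d)%fset ->
  galg_map x = \sum_(g <- d) << x@_g *g f g >>.
Proof.
move=> le_d; rewrite /galg_map (big_fset_incl _ le_d) // => g _.
by move/mcoeff_outdom->; rewrite monalgU0.
Qed.

Lemma galg_map0 : galg_map 0 = 0.
Proof. by rewrite /galg_map msupp0 big_seq_fset0. Qed.

Lemma galg_mapD x y : galg_map (x + y) = galg_map x + galg_map y.
Proof.
rewrite (galg_mapEw (msuppD_le _ _)).
rewrite (galg_mapEw (fsubsetUl (msupp x) (msupp y))).
rewrite (galg_mapEw (fsubsetUr (msupp x) (msupp y))).
rewrite -big_split /=; apply/eq_bigr=> g _.
by rewrite mcoeffD monalgUD.
Qed.

Lemma galg_mapU c g : galg_map << c *g g >> = << c *g f g >>.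
Proof. by rewrite (galg_mapEw msuppU_le) big_seq_fset1 mcoeffUU. Qed.

Lemma galg_map_sum (I : eqType) (r : seq I) (E : I -> galg F G) :
  galg_map (\sum_(i <- r) E i) = \sum_(i <- r) galg_map (E i).
Proof. exact: (big_morph _ galg_mapD galg_map0). Qed.

Lemma galg_mapM x y :
    {in msupp x & msupp y, {morph f : g h / (g * h)%g >-> (g * h)%g}} ->
  galg_map (x * y) = galg_map x * galg_map y.
Proof.
move=> fM; rewrite [x * y]/(galg_mul x y) /galg_mul galg_map_sum.
rewrite [in RHS]/galg_map mulr_suml; apply: eq_big_seq => g gx.
rewrite galg_map_sum mulr_sumr; apply: eq_big_seq => h hy.
by rewrite galg_mapU galgMUU fM.
Qed.

Lemma galg_map_star x : {in msupp x, {morph f : g / (g^-1)%g >-> (g^-1)%g}} ->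
  galg_map (star x) = star (galg_map x).
Proof.
move=> fV; rewrite [in LHS]/star galg_map_sum [in RHS]/galg_map.
rewrite [RHS](big_morph _ (@starD F H) (@star0 F H)).
by apply: eq_big_seq => g gx; rewrite galg_mapU starU fV.
Qed.

Lemma augmentation_map x : augmentation (galg_map x) = augmentation x.
Proof.
rewrite /galg_map (big_morph _ (@augmentationD F H) (@augmentation0 F H)).
by apply: eq_bigr => g _; rewrite augmentationU.
Qed.

Lemma mcoeff_map x g : {in msupp x, forall h, f h = f g -> h = g} ->
  (galg_map x)@_(f g) = x@_g.
Proof.
move=> fI; rewrite /galg_map raddf_sum /=.
have [gx|gx] := msuppP x g; last first.
  rewrite big_seq big1 // => h hx; rewrite mcoeffU; case: eqP => // e.
  by move: gx; rewrite -(fI h hx e) hx.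
rewrite (big_fsetD1 _ gx) /= mcoeffU eqxx mulr1n big_seq big1 ?addr0 // => h.
rewrite in_fsetD1 => /andP[nhg hx]; rewrite mcoeffU.
by case: eqP => // /(fI h hx) e; rewrite e eqxx in nhg.
Qed.

Lemma mcoeff_map_out x k : {in msupp x, forall h, f h != k} ->
  (galg_map x)@_k = 0.
Proof.
move=> nf; rewrite /galg_map raddf_sum /= big_seq big1 // => h /nf/negPf e.
by rewrite mcoeffU e.
Qed.
End Map.

Lemma galg_mapK (F : fieldType) (G H : groupType) (f : G -> H) (f' : H -> G) :
  cancel f f' -> cancel (@galg_map F G H f) (galg_map f').
Proof.
move=> fK; elim/galg_ind => [|x y IHx IHy|c g]; first by rewrite !galg_map0.
  by rewrite !galg_mapD IHx IHy.
by rewrite !galg_mapU fK.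
Qed.

Section UnitaryUnits.
Variables (F : fieldType) (G : groupType).
Implicit Types (x y : galg F G) (u v : unitary_unit F G).

Definition unitary_element x := [/\ x * star x = 1, star x * x = 1 & augmentation x = 1].

Definition uval u : galg F G := val (val u).

Lemma uval_inj : injective uval.
Proof. by move=> u v /val_inj/val_inj. Qed.

Lemma uvalM u v : uval (u * v)%g = uval u * uval v.
Proof. by []. Qed.
Lemma uvalX u n : uval (u ^+ n)%g = uval u ^+ n.
Proof. by elim: n => // n IHn; rewrite expgS exprS uvalM IHn. Qed.

Lemma uval_unitary u : unitary_element (uval u).
Proof.
have /eqP e : unitary (val u) by case: u.
by rewrite /unitary_element -e divrr ?mulVr ?nunit_unit // nunit_augmentation.
Qed.

Definition to_unitary x : unitary_unit F G :=
  insubd 1%g (insubd (1%g : normalized_unit F G) x).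

Lemma to_unitaryK x : unitary_element x -> uval (to_unitary x) = x.
Proof.
case=> xs sx ax.
have Ux : x \is a GRing.unit by apply/unitrP; exists (star x).
rewrite /uval /to_unitary.
have e : val (insubd (1%g : normalized_unit F G) x) = x.
  by rewrite insubdK // unfold_in Ux ax eqxx.
rewrite insubdK // unfold_in /unitary e; apply/eqP.
by apply: (mulrI Ux); rewrite divrr.
Qed.
End UnitaryUnits.

Lemma morph_group_isomorphic (G H : groupType) (f : G -> H) :
  {morph f : x y / (x * y)%g >-> (x * y)%g} -> bijective f -> group_isomorphic G H.
Proof.
move=> fM bij_f; pose m := monoid.isMultiplicative.Build G H f fM.
by exists (HB.pack f m : {multiplicative G -> H}).
Qed.

Lemma multiplicative1 (G H : groupType) (f : {multiplicative G -> H}) : f 1%g = 1%g.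
Proof. by apply: (mulgI (f 1%g)); rewrite -gmulfM !mulg1. Qed.

Lemma multiplicativeX (G H : groupType) (f : {multiplicative G -> H}) n :
  {morph f : x / (x ^+ n)%g}.
Proof.
move=> x; elim: n => [|n IHn]; first by rewrite !expg0 multiplicative1.
by rewrite !expgS gmulfM IHn.
Qed.

Lemma group_isomorphic_sym (G H : groupType) :
  group_isomorphic G H -> group_isomorphic H G.
Proof.
case=> f [f' fK f'K].
have f'M : {morph f' : x y / (x * y)%g} by move=> x y; apply: (can_inj fK); rewrite gmulfM !f'K.
by apply: morph_group_isomorphic f'M _; exists f.
Qed.

Lemma unitary_unit_isomorphic (F : fieldType) (G H : groupType) :
  group_isomorphic G H -> group_isomorphic (unitary_unit F G) (unitary_unit F H).
Proof.
case=> f [f' fK f'K].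
have f'M : {morph f' : x y / (x * y)%g} by move=> x y; apply: (can_inj fK); rewrite gmulfM !f'K.
have U (A B : groupType) (h : A -> B) (x : galg F A) : {morph h : x y / (x * y)%g} ->
   unitary_element x -> unitary_element (galg_map h x).
  move=> hM [xs sx ax].
  have h1 : h 1%g = 1%g by apply: (mulgI (h 1%g)); rewrite -hM !mulg1.
  have hV : {morph h : x / (x^-1)%g}.
    by move=> a; apply: (mulgI (h a)); rewrite -hM !mulgV h1.
  rewrite /unitary_element -galg_map_star => [|a _]; last exact: hV.
  have mapM (y z : galg F A) : galg_map h (y * z) = galg_map h y * galg_map h z.
    by apply: galg_mapM => a b _ _; apply: hM.
  by rewrite -!mapM xs sx augmentation_map ax galg1E galg_mapU h1.
have fM : {morph f : x y / (x * y)%g} by move=> x y; rewrite gmulfM.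
have ex_map (A B : groupType) (h : A -> B) : {morph h : x y / (x * y)%g} ->
    exists m : unitary_unit F A -> unitary_unit F B,
      forall u, uval (m u) = galg_map h (uval u).
  move=> hM; exists (fun u => to_unitary (galg_map h (uval u))) => u.
  by apply/to_unitaryK/U => //; apply: uval_unitary.
have [m mE] := ex_map _ _ _ fM; have [m' m'E] := ex_map _ _ _ f'M.
have mM : {morph m : x y / (x * y)%g}.
  move=> u v; apply: uval_inj; rewrite [RHS]uvalM 3!mE [in LHS]uvalM.
  by apply: galg_mapM => a b _ _; apply: fM.
apply: (morph_group_isomorphic mM); exists m' => u; apply: uval_inj.
  by rewrite m'E mE galg_mapK.
by rewrite mE m'E galg_mapK.
Qed.

(** * Finiteness of the second group *)

Section FiniteGroup.
Variables (T : finType) (H : groupType) (i : H -> T).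

(** A type synonym that can carry the finite structure deduced from an injection
    into a finite type. *)
Definition finite_copy (inj_i : injective i) : Type := H.

Hypothesis inj_i : injective i.
Local Notation Hf := (finite_copy inj_i).

HB.instance Definition _ := Group.copy Hf H.

Let i' (t : T) : option Hf :=
  if pselect (exists h, i h = t) is left ex then Some (projT1 (cid ex)) else None.
Fact finite_copyK : pcancel (i : Hf -> T) i'.
Proof.
move=> h; rewrite /i'; case: pselect => [ex|[]]; last by exists h.
by congr Some; case: cid => h' /= /inj_i.
Qed.
HB.instance Definition _ : isCountable Hf := PCanIsCountable finite_copyK.
HB.instance Definition _ : isFinite Hf := PCanIsFinite finite_copyK.
Lemma finite_group_copy : exists K : finGroupType, group_isomorphic H K.
Proof.
exists (Hf : finGroupType).
by apply: (@morph_group_isomorphic H Hf idfun) => //; exists idfun.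
Qed.
End FiniteGroup.

Section Finite.
Variables (F : finFieldType) (G : finGroupType) (cG : abelian [set: G]).
Variable p : nat.
Hypotheses (pcharF : p \in [pchar F]) (pG : (p.-group [set: G])%g).
Local Notation unitaries := (unitaries F cG [set: G]%G).

Lemma unitaries_uval (u : unitary_unit F G) : (uval u : abgalg F cG) \in unitaries.
Proof.
have [xs sx ax] := uval_unitary u.
apply/unitariesP; split; last by rewrite abgalgM conjE.
by apply/normalizedP; rewrite supported_all.
Qed.

Lemma unitary_element_mem (x : abgalg F cG) : x \in unitaries -> unitary_element x.
Proof.
case/unitariesP => /normalizedP[_ ax]; rewrite abgalgM conjE => xs.
by split=> //; move: (xs); rewrite -{1}conjE -abgalgM mulrC abgalgM conjE.
Qed.

(** $H$ embeds into $V_!(FH)$, hence into the finite commutative ring $FG$, where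
    all elements of augmentation $1$ have order a power of $p$. *)
Lemma group_of_isomorphic_unitaries (H : groupType) :
    group_isomorphic (unitary_unit F G) (unitary_unit F H) ->
  exists K : finGroupType, [/\ group_isomorphic H K, abelian [set: K] & (p.-group [set: K])%g].
Proof.
case=> f [f' fK f'K].
have f'M : {morph f' : x y / (x * y)%g}.
  by move=> x y; apply: (can_inj fK); rewrite gmulfM !f'K.
have Uh (h : H) : unitary_element (<< 1 *g h >> : galg F H).
  by rewrite /unitary_element starU augmentationU !galgMUU mulr1 mulgV mulVg.
have [e eE] : exists e : H -> unitary_unit F H, forall h, uval (e h) = << 1 *g h >>.
  by exists (fun h => to_unitary << 1 *g h >>) => h; apply: to_unitaryK.
have eM : {morph e : x y / (x * y)%g}.
  by move=> x y; apply: uval_inj; rewrite [RHS]uvalM !eE galgMUU mulr1.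
have [i iE] : exists i : H -> abgalg F cG, forall h, i h = uval (f' (e h)).
  by exists (fun h => uval (f' (e h))).
have iM : {morph i : x y / (x * y)%g >-> x * y}.
  by move=> x y; rewrite !iE eM f'M uvalM abgalgM.
have inj_i : injective i.
  move=> x y; rewrite !iE => /uval_inj/(can_inj f'K) exy.
  have := congr1 (fun u => (uval u)@_x) exy; rewrite !eE !mcoeffU eqxx.
  by case: eqP => // _ /eqP; rewrite oner_eq0.
have [K isoK] := finite_group_copy inj_i.
exists K; split=> //; case: (group_isomorphic_sym isoK) => j [j' jK j'K].
  apply/centsP => x _ y _; apply: (can_inj jK); rewrite /= !gmulfM.
  by apply: inj_i; rewrite !iM mulrC.
have i1 : i 1%g = 1.
  have Ui : i 1%g \is a GRing.unit.
    by apply: (normalized_invertible pcharF pG (K := [set: G]%G)); rewrite iE; case/unitariesP: (unitaries_uval (f' (e 1%g))).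
  by apply: (mulrI Ui); rewrite -iM !mulg1 mulr1.
rewrite -pnat_exponent; apply: (@pnat_dvd _ (p ^ #|G|)%N); last first.
  by rewrite pnatX pnat_id ?(pcharf_prime pcharF).
have j1 : j 1%g = 1%g := multiplicative1 j.
apply/exponentP => x _; apply: (can_inj jK); rewrite [RHS]j1.
apply: inj_i; rewrite i1.
have iX n : i (j (x ^+ n)%g) = i (j x) ^+ n.
  elim: n => [|n IHn]; first by rewrite expg0 [j _]j1 i1.
  by rewrite expgS gmulfM iM IHn exprS.
rewrite iX (expr_aug1 pcharF pG) //.
by rewrite iE; have [_ _] := uval_unitary (f' (e (j x))).
Qed.
End Finite.

Section Transfer.
Variables (F : finFieldType) (G H : finGroupType).
Variables (cG : abelian [set: G]) (cH : abelian [set: H]).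

Lemma leq_card_unitary_powers n :
    group_isomorphic (unitary_unit F G) (unitary_unit F H) ->
  (#|[set x ^+ n | x in unitaries F cG [set: G]%G]| <=
   #|[set x ^+ n | x in unitaries F cH [set: H]%G]|)%N.
Proof.
case=> f [f' fK f'K].
have tuK (K : finGroupType) (cK : abelian [set: K]) (x : abgalg F cK) :
    x \in unitaries F cK [set: K]%G -> uval (to_unitary x) = x.
  by move/unitary_element_mem/to_unitaryK.
have [m mE] : exists m : abgalg F cG -> abgalg F cH,
    forall x, m x = uval (f (to_unitary x)).
  by exists (fun x => uval (f (to_unitary x))).
have mX x k : x \in unitaries F cG [set: G]%G -> m (x ^+ k) = m x ^+ k.
  move=> Ux; have Uxk := unitariesX k Ux.
  rewrite !mE; have -> : to_unitary (x ^+ k) = (to_unitary x ^+ k)%g.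
    by apply: uval_inj; rewrite tuK // uvalX tuK // abgalgX.
  by rewrite multiplicativeX uvalX abgalgX.
have inj_m : {in unitaries F cG [set: G]%G &, injective m}.
  move=> x y Ux Uy; rewrite !mE => /uval_inj/(can_inj fK)/(congr1 (@uval F G)).
  by rewrite !tuK.
rewrite -(@card_in_imset _ _ m) => [|_ _ /imsetP[x Ux ->] /imsetP[y Uy ->]]; last first.
  by apply: inj_m; apply: unitariesX.
apply/subset_leq_card/subsetP => _ /imsetP[_ /imsetP[x Ux ->] ->].
rewrite mX //; apply/imsetP; exists (m x) => //.
by rewrite mE; apply: unitaries_uval.
Qed.
End Transfer.

(** * Comparison of the groups of powers *)

Section Powers.
Variables (F : finFieldType) (G : finGroupType) (cG : abelian [set: G]).
Variable p : nat.
Hypotheses (pcharF : p \in [pchar F]) (pG : (p.-group [set: G])%g).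
Local Notation A := (abgalg F cG).
Local Notation unitaries := (unitaries F cG).
Local Notation coboundaries := (coboundaries F cG).
Implicit Types K : {group G}.

Lemma unitaries_exprp K :
  [set x ^+ p | x in unitaries K] = coboundaries 'Mho^1(K)%G.
Proof.
apply/eqP; rewrite eqEsubset; apply/andP; split; last first.
  rewrite -(coboundaries_exprp cG pcharF pG) imsetS //.
  exact: coboundaries_unitary pcharF pG K.
have [p2|op] := even_prime (pcharf_prime pcharF).
  subst p; apply/subsetP => _ /imsetP[x Kx ->].
  exact: unitaries_sqr.
by rewrite (unitaries_odd cG pcharF pG) // (coboundaries_exprp cG pcharF pG).
Qed.

Lemma Mho1_Mho K i : 'Mho^1('Mho^i(K))%g = 'Mho^i.+1(K)%g.
Proof.
have pK : (p.-group K)%g := pgroupS (subsetT K) pG.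
have cK : abelian K := abelianS (subsetT K) cG.
rewrite (Mho1E cG pG) (MhoEabelian i.+1 pK cK) /=.
rewrite [in LHS](MhoEabelian i pK cK) -imset_comp.
by apply: eq_imset => x /=; rewrite -expgM -expnSr.
Qed.

Lemma unitaries_exprpn K i :
  [set x ^+ (p ^ i.+1) | x in unitaries K] = coboundaries 'Mho^i.+1(K)%G.
Proof.
elim: i => [|i IHi]; first by rewrite -unitaries_exprp expn1.
have -> : 'Mho^i.+2(K)%G = 'Mho^1('Mho^i.+1(K))%G by apply/val_inj; rewrite /= Mho1_Mho.
rewrite -(coboundaries_exprp cG pcharF pG) -IHi -imset_comp.
by apply: eq_imset => x /=; rewrite -exprM -expnSr.
Qed.
End Powers.

Section Compare.
Variables (F : finFieldType) (G H : finGroupType).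
Variables (cG : abelian [set: G]) (cH : abelian [set: H]).
Variable p : nat.
Hypotheses (pcharF : p \in [pchar F]).
Hypotheses (pG : (p.-group [set: G])%g) (pH : (p.-group [set: H])%g).
Variables (K : {group G}) (L : {group H}) (f : {morphism K >-> H}).
Hypotheses (inj_f : ('injm f)%g) (fKL : (f @* K)%g \subset L).
Local Notation AG := (abgalg F cG).
Local Notation AH := (abgalg F cH).

Definition abgalg_map (x : AG) : AH := galg_map f x.

Lemma msupp_supported (x : AG) : x \in supported K -> {in msupp x, forall g, g \in K}.
Proof.
move/supportedP => sx g; apply: contraTT => /sx; rewrite /gcoef => x0.
by rewrite -mcoeff_neq0 x0 eqxx.
Qed.

Lemma abgalg_mapM : {in supported K &, {morph abgalg_map : x y / x * y}}.
Proof.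
move=> x y /msupp_supported sx /msupp_supported sy; rewrite !abgalgM.
by apply: galg_mapM => g h /sx Kg /sy Kh; apply: morphM.
Qed.

Lemma abgalg_map_conj (x : AG) : x \in supported K ->
  abgalg_map (conj x) = conj (abgalg_map x).
Proof.
move=> /msupp_supported sx; rewrite !conjE.
by apply: galg_map_star => g /sx Kg; apply: morphV.
Qed.

Lemma abgalg_map_mon g : abgalg_map (mon F cG g) = mon F cH (f g).
Proof. exact: galg_mapU. Qed.

Lemma aug_abgalg_map (x : AG) : aug (abgalg_map x) = aug x.
Proof. exact: augmentation_map. Qed.

Lemma gcoef_abgalg_map (x : AG) g : x \in supported K -> g \in K ->
  gcoef (abgalg_map x) (f g) = gcoef x g.
Proof.
move=> /msupp_supported sx Kg; apply: mcoeff_map => h /sx Kh.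
exact: (injmP inj_f).
Qed.

Lemma abgalg_map_supported (x : AG) : x \in supported K ->
  abgalg_map x \in supported (f @* K)%G.
Proof.
move=> /msupp_supported sx; apply/supportedP => k nk; apply: mcoeff_map_out => h /sx Kh.
by apply: contraNneq nk => <-; rewrite mem_morphim.
Qed.

Lemma abgalg_map_inj : {in supported K &, injective abgalg_map}.
Proof.
move=> x y sx sy e; apply: gcoefP => g.
have [Kg|nKg] := boolP (g \in K).
  by rewrite -(gcoef_abgalg_map sx Kg) e gcoef_abgalg_map.
by rewrite (supportedP _ _ sx) // (supportedP _ _ sy).
Qed.

Lemma abgalg_map_normalized y : y \in normalized F cG K ->
  abgalg_map y \in normalized F cH L.
Proof.
case/normalizedP => sy ay; apply/normalizedP; rewrite aug_abgalg_map ay; split=> //.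
exact: supportedS fKL (abgalg_map_supported sy).
Qed.

Lemma abgalg_map1 : abgalg_map 1 = 1.
Proof. by rewrite -(mon1 F cG) abgalg_map_mon morph1 mon1. Qed.

Lemma abgalg_mapV y : y \in normalized F cG K ->
  abgalg_map y^-1 = (abgalg_map y)^-1.
Proof.
move=> ny; have Uy := normalized_invertible pcharF pG ny.
have Umy := normalized_invertible pcharF pH (abgalg_map_normalized ny).
have [sy _] := normalizedP _ _ ny.
have [sV _] := normalizedP _ _ (normalizedV pcharF pG ny).
by apply: (mulrI Umy); rewrite divrr // -abgalg_mapM // divrr // abgalg_map1.
Qed.

Lemma abgalg_map_unitaries x : x \in unitaries F cG K ->
  abgalg_map x \in unitaries F cH L.
Proof.
case/unitariesP => nx xx; have [sx _] := normalizedP _ _ nx.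
apply/unitariesP; rewrite abgalg_map_normalized //; split=> //.
by rewrite -abgalg_map_conj // -abgalg_mapM ?supported_conj // xx abgalg_map1.
Qed.

Lemma abgalg_map_coboundaries x : x \in coboundaries F cG K ->
  abgalg_map x \in coboundaries F cH L.
Proof.
case/coboundariesP => k [y [Kk ny ->]]; apply/coboundariesP.
have nyc := normalized_conj ny.
have [sy _] := normalizedP _ _ ny.
have [sV _] := normalizedP _ _ (normalizedV pcharF pG nyc).
exists (f k), (abgalg_map y); split; last 1 first.
- rewrite abgalg_mapM ?mem_supported_mon ?rpredM // abgalg_mapM // abgalg_mapV //.
  by rewrite abgalg_map_mon abgalg_map_conj.
- by rewrite (subsetP fKL) ?mem_morphim.
exact: abgalg_map_normalized.
Qed.

(** If $X$ is at least as large as $Y$, the injection of $X$ into $Y$ is onto, so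
    every element of $L$ is supported on the image of $K$. *)
Lemma embedding_full (X : {set AG}) (Y : {set AH}) :
    {in X, forall x, x \in supported K} -> {in X, forall x, abgalg_map x \in Y} ->
    {in L, forall l, mon F cH l \in Y} ->
  (#|Y| <= #|X|)%N -> (f @* K)%g = L.
Proof.
move=> XK XY LY leYX; apply/eqP; rewrite eqEsubset fKL /=.
have XYE : abgalg_map @: X = Y.
  apply/eqP; rewrite eqEcard card_in_imset; last first.
    by move=> x y /XK sx /XK sy; apply: abgalg_map_inj.
  by rewrite leYX andbT; apply/subsetP => _ /imsetP[x /XY Xx ->].
apply/subsetP => l /LY; rewrite -XYE => /imsetP[x /XK sx lx].
by rewrite -(mem_supported_mon F cH (f @* K)%G) lx abgalg_map_supported.
Qed.

Lemma unitaries_embedding_full :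
  (#|unitaries F cH L| <= #|unitaries F cG K|)%N -> (f @* K)%g = L.
Proof.
apply: embedding_full => [x /unitariesP[/normalizedP[]] //|x|l].
  exact: abgalg_map_unitaries.
exact: unitaries_mon.
Qed.

Lemma coboundaries_embedding_full :
  (#|coboundaries F cH L| <= #|coboundaries F cG K|)%N -> (f @* K)%g = L.
Proof.
apply: embedding_full => [x|x|l].
- move/(subsetP (coboundaries_unitary cG pcharF pG K)).
  by case/unitariesP => /normalizedP[].
- exact: abgalg_map_coboundaries.
exact: coboundaries_mon.
Qed.

End Compare.

(** * Abelian groups with the same powers *)

Section AbelianTypes.
Local Open Scope group_scope.
Local Open Scope nat_scope.
Variable p : nat.
Hypothesis p_pr : prime p.

Lemma sorted_geq_nth (t : seq nat) i m : sorted geq t ->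
  (m < nth 0 t i) = (i < count (ltn m) t).
Proof.
elim: t i => [|a t IHt] i; first by rewrite nth_nil.
move=> /= sa; have st := path_sorted sa.
have zero : a <= m -> count (ltn m) t = 0.
  move=> leam; apply/eqP; rewrite eqn0Ngt -has_count; apply/hasPn => b tb /=.
  rewrite -leqNgt; apply: leq_trans leam.
  by move: sa; rewrite (path_sortedE (rev_trans leq_trans)) => /andP[/allP/(_ _ tb)].
case: i => [|i] /=; first by case: (ltnP m a) => // /zero->.
by rewrite IHt //; case: (ltnP m a) => [_|/zero->]; rewrite ?add1n ?ltnS.
Qed.

Lemma card_Mho_index (gT : finGroupType) (K : {group gT}) n : abelian K ->
  #|'Mho^n(K)| = #|'Ohm_n.+1(K) : 'Ohm_n(K)| * #|'Mho^n.+1(K)|.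
Proof.
move=> cK; apply/eqP; rewrite -(eqn_pmul2l (cardG_gt0 'Ohm_n(K))) mulnA.
by rewrite Lagrange ?Ohm_leq // !mul_card_Ohm_Mho_abelian.
Qed.

Lemma count_order_gt (gT : finGroupType) (K : {group gT}) b n :
    p.-group K -> \big[dprod/1%g]_(x <- b) <[x]> = K ->
  count (ltn (p ^ n)) (map order b) = logn p #|'Ohm_n.+1(K) : 'Ohm_n(K)|.
Proof.
move=> pK defK; rewrite -(count_logn_dprod_cycle _ _ defK) count_map.
apply: eq_in_count => x bx /=.
have Kx : x \in K.
  rewrite -cycle_subG -(bigdprodWY defK) sub_gen //.
  by rewrite (big_rem x bx) subsetUl.
have px := mem_p_elt pK Kx.
rewrite -{1}(part_pnat_id px) p_part ltn_exp2l ?prime_gt1 //.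
Qed.

(** Order the invariants of $K$ and $L$ decreasingly. The number of invariants
    above $p^n$ is determined by $|K^{p^n}| / |K^{p^{n+1}}|$, so it is the same
    for $K$ and $L$ when $n > 0$, and at most as large for $K$ when $n = 0$. Hence
    the invariants of $K$ are the first ones of $L$. *)
Lemma abelian_embedding (gT hT : finGroupType) (K : {group gT}) (L : {group hT}) :
    p.-group K -> p.-group L -> abelian K -> abelian L ->
    (forall i, #|'Mho^i.+1(K)| = #|'Mho^i.+1(L)|) -> #|K| <= #|L| ->
  exists2 f : {morphism K >-> hT}, 'injm f & f @* K \subset L.
Proof.
move=> pK pL cK cL eqM leKL.
have [bK defK tK] := abelian_structure cK.
have [bL defL tL] := abelian_structure cL.
(* The number of cyclic factors of order larger than p^n. *)
pose c n (gT : finGroupType) (K : {group gT}) := logn p #|'Ohm_n.+1(K) : 'Ohm_n(K)|.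
have eqc n : c n.+1 _ K = c n.+1 _ L.
  rewrite /c; congr (logn p _); apply/eqP.
  rewrite -(eqn_pmul2r (cardG_gt0 'Mho^n.+2(K))) -card_Mho_index //.
  by rewrite [in X in _ == X]eqM -card_Mho_index // eqM.
have p_idx (rT : finGroupType) (M : {group rT}) n : p.-group M -> p.-nat #|'Ohm_n.+1(M) : 'Ohm_n(M)|.
  move=> pM; apply: pnat_dvd (dvdn_indexg _ _) _.
  by apply: pgroupS pM; apply: Ohm_sub.
have lec : c 0 _ K <= c 0 _ L.
  rewrite /c -(leq_exp2l _ _ (prime_gt1 p_pr)) -!p_part !part_pnat_id ?p_idx //.
  rewrite -(leq_pmul2r (cardG_gt0 'Mho^1(K))) -card_Mho_index // eqM.
  by rewrite -card_Mho_index // !Mho0.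
have cE n (rT : finGroupType) (M : {group rT}) : p.-group M -> abelian M ->
    count (ltn (p ^ n)) (abelian_type M) = c n _ M.
  by move=> pM /abelian_structure[b defM <-]; apply: count_order_gt.
have sizeE (rT : finGroupType) (M : {group rT}) : p.-group M -> abelian M ->
    size (abelian_type M) = c 0 _ M.
  move=> pM cM; rewrite -cE // expn0; apply/esym/eqP; rewrite -all_count.
  exact: abelian_type_gt1.
have pow (rT : finGroupType) (M : {group rT}) i : p.-group M -> abelian M ->
    exists m, nth 0 (abelian_type M) i = if i < c 0 _ M then p ^ m else 0.
  move=> pM cM; rewrite -sizeE //; case: ltnP => [lti|]; last first.
    by move=> lti; exists 0; rewrite nth_default.
  have [b defM tM] := abelian_structure cM.
  have := mem_nth 0 lti; rewrite -{2}tM => /mapP[x bx ->].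
  have Mx : x \in M.
    rewrite -cycle_subG -(bigdprodWY defM) sub_gen //.
    by rewrite (big_rem x bx) subsetUl.
  by have [m ->] := p_natP (mem_p_elt pM Mx); exists m.
have take_type : take (size bK) (abelian_type L) = abelian_type K.
  have sK : size bK = c 0 _ K by rewrite -sizeE // -tK size_map.
  have szE : size (take (size bK) (abelian_type L)) = c 0 _ K.
    by rewrite size_takel sK ?sizeE.
  apply: (@eq_from_nth _ 0) => [|i]; rewrite szE ?sizeE // => lti.
  rewrite nth_take ?sK //.
  have cmp n : (p ^ n < nth 0 (abelian_type L) i) = (p ^ n < nth 0 (abelian_type K) i).
    rewrite !sorted_geq_nth ?abelian_type_sorted // !cE //.
    case: n => [|n]; last by rewrite eqc.
    by rewrite lti (leq_trans lti lec).
  have [m mE] := pow _ _ i pK cK; have [m' m'E] := pow _ _ i pL cL.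
  move: cmp; rewrite mE m'E lti (leq_trans lti lec) => cmp; congr (p ^ _).
  have lt n k : (p ^ n < p ^ k) = (n < k) by rewrite ltn_exp2l ?prime_gt1.
  apply/eqP; rewrite eqn_leq leqNgt -lt cmp lt ltnn /=.
  by rewrite leqNgt -lt -cmp lt ltnn.
have: \big[dprod/1%g]_(x <- take (size bK) bL ++ drop (size bK) bL) <[x]> = L.
  by rewrite cat_take_drop.
rewrite big_cat => /dprodP[[M M' defM defM'] defL' _ _].
have sML : M \subset L by rewrite -defL' defM defM' mulG_subl.
have isoKM : K \isog M.
  rewrite eq_abelian_type_isog ?(abelianS sML) //; apply/eqP.
  have pM : p.-group M := pgroupS sML pL.
  have nt : 1%g \notin take (size bK) bL.
    apply: contraL (abelian_type_gt1 L) => /mem_take bL1; apply/allPn; exists 1 => //.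
    by rewrite -tL; apply/mapP; exists 1%g => //; rewrite order1.
  have := abelian_type_pgroup pM defM nt.
  rewrite map_take tL take_type => perm_MK.
  apply: (@sorted_eq _ geq) => //; first exact: rev_trans leq_trans.
  - by move=> m n; rewrite andbC; apply: anti_leq.
  - exact: abelian_type_sorted.
  - exact: abelian_type_sorted.
  by rewrite perm_sym.
have [f inj_f fK] := isogP isoKM.
by exists f; rewrite // fK.
Qed.
End AbelianTypes.

Lemma group_isomorphic_trans (A B C : groupType) :
  group_isomorphic A B -> group_isomorphic B C -> group_isomorphic A C.
Proof.
case=> f bf [g bg]; apply: (@morph_group_isomorphic A C (g \o f)).
  by move=> x y /=; rewrite !gmulfM.
exact: bij_comp.
Qed.

Lemma isog_group_isomorphic (G H : finGroupType) :
  ([set: G] \isog [set: H])%g -> group_isomorphic G H.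
Proof.
case/isogP => f inj_f fG; apply: (@morph_group_isomorphic G H f).
  by move=> x y; rewrite morphM ?inE.
have injf : injective f by move=> x y; apply: (injmP inj_f); rewrite inE.
apply: inj_card_bij injf _.
by rewrite -!cardsT -fG card_injm.
Qed.

(** * Recovering the group *)

Section Recover.
Variables (F : finFieldType) (p : nat).
Hypothesis pcharF : p \in [pchar F].

Lemma Mho_Mho (G : finGroupType) (cG : abelian [set: G]) (pG : (p.-group [set: G])%g)
    (K : {group G}) i j : 'Mho^j('Mho^i(K))%g = 'Mho^(i + j)(K)%g.
Proof.
elim: j => [|j IHj]; first by rewrite addn0 Mho0.
by rewrite -(Mho1_Mho cG pG) IHj (Mho1_Mho cG pG) addnS.
Qed.

(** The embedding between the groups of $p^i$-th powers is onto, as the groups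
    $V_!(F -)^{p^i}$ of both sides have the same order. For $i = 0$ this compares
    unitary groups, for $i > 0$ the groups $U$. *)
Lemma card_Mho_step (G H : finGroupType) (cG : abelian [set: G]) (cH : abelian [set: H])
    (pG : (p.-group [set: G])%g) (pH : (p.-group [set: H])%g) i :
    group_isomorphic (unitary_unit F G) (unitary_unit F H) ->
    (forall j, i < j -> #|'Mho^j([set: G])%g| = #|'Mho^j([set: H])%g|)%N ->
    (#|'Mho^i([set: G])%g| <= #|'Mho^i([set: H])%g|)%N ->
  #|'Mho^i([set: G])%g| = #|'Mho^i([set: H])%g|.
Proof.
move=> isoV eqM leM; pose K := 'Mho^i([set: G])%G; pose L := 'Mho^i([set: H])%G.
have pK : (p.-group K)%g := pgroupS (subsetT K) pG.
have pL : (p.-group L)%g := pgroupS (subsetT L) pH.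
have cK : abelian K := abelianS (subsetT K) cG.
have cL : abelian L := abelianS (subsetT L) cH.
have eqKL j : #|'Mho^j.+1(K)%g| = #|'Mho^j.+1(L)%g|.
  by rewrite (Mho_Mho cG pG) (Mho_Mho cH pH) eqM // addnS ltnS leq_addr.
have [f inj_f fKL] := abelian_embedding (pcharf_prime pcharF) pK pL cK cL eqKL leM.
have leV n := leq_card_unitary_powers cH cG n (group_isomorphic_sym isoV).
suff fK : (f @* K)%g = L by rewrite -[RHS]/#|L| -fK card_injm.
case: i @K @L pK pL cK cL f inj_f fKL {eqM leM eqKL} => [|i] K L pK pL cK cL f inj_f fKL.
  apply: (unitaries_embedding_full (F := F) (cG := cG) (cH := cH) inj_f fKL).
  have := leV 1%N; rewrite !imset_id.
  by have [-> ->] : K = [set: G]%G /\ L = [set: H]%G by split; apply/val_inj/Mho0.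
apply: (coboundaries_embedding_full pcharF pG pH inj_f fKL).
by rewrite -(unitaries_exprpn cG pcharF pG) -(unitaries_exprpn cH pcharF pH).
Qed.
End Recover.

Theorem theorem1 (p : nat) (F : finFieldType) (G : finGroupType)
    (H : groupType) :
  prime p -> p \in [pchar F]%R -> abelian [set: G] -> (p.-group [set: G])%g ->
  (group_isomorphic (unitary_unit F G) (unitary_unit F H)
     <-> group_isomorphic G H).
Proof.
move=> p_pr pcharF cG pG; split; last exact: unitary_unit_isomorphic.
move=> isoV.
have [K [isoHK cK pK]] := group_of_isomorphic_unitaries cG pcharF pG isoV.
have {}isoV := group_isomorphic_trans isoV (unitary_unit_isomorphic F isoHK).
apply: group_isomorphic_trans (group_isomorphic_sym isoHK).
pose n := (#|G| + #|K|)%N.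
have trivM (T : finGroupType) i : (p.-group [set: T])%g -> abelian [set: T] ->
    (#|T| <= i)%N -> #|'Mho^i([set: T])%g| = 1%N.
  move=> pT cT leTi; apply/eqP; rewrite -trivg_card1; apply/eqP/trivgP.
  have E : 'Mho^i([set: T])%g = [set (x ^+ (p ^ i))%g | x in [set: T]].
    exact: MhoEabelian pT cT.
  rewrite /= E.
  apply/subsetP => _ /imsetP[x _ ->]; rewrite inE -order_dvdn.
  have [m xm] := p_natP (mem_p_elt pT (in_setT x)).
  rewrite [X in (X %| _)%N]xm dvdn_exp2l // (leq_trans _ leTi) //.
  rewrite (leq_trans (ltnW (ltn_expl m (prime_gt1 p_pr)))) // -xm.
  by rewrite -cardsT subset_leq_card ?subsetT.
have eqM d i : (n <= i + d)%N -> #|'Mho^i([set: G])%g| = #|'Mho^i([set: K])%g|.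
  elim: d i => [|d IHd] i.
    rewrite addn0 => leni; rewrite !trivM //; apply: leq_trans leni.
      exact: leq_addl.
    exact: leq_addr.
  move=> leni; have eqj j : (i < j)%N -> #|'Mho^j([set: G])%g| = #|'Mho^j([set: K])%g|.
    move=> ltij; apply: IHd; apply: leq_trans leni _.
    by rewrite addnS -addSn leq_add2r.
  have [le|/ltnW le] := leqP #|'Mho^i([set: G])%g| #|'Mho^i([set: K])%g|.
    exact: (card_Mho_step pcharF cG cK).
  apply/esym; apply: (card_Mho_step pcharF cK cG) => //.
    exact: group_isomorphic_sym.
  by move=> j ltij; rewrite eqj.
have eq0 : #|[set: G]| = #|[set: K]|.
  by have := eqM n 0%N (leqnn _); rewrite !Mho0.
have [f inj_f fGK] := abelian_embedding p_pr pG pK cG cK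
  (fun i => eqM n i.+1 (leq_addl _ _)) (eq_leq eq0).
apply/isog_group_isomorphic/isogP; exists f => //.
by apply/eqP; rewrite eqEcard fGK card_injm //; apply: eq_leq; rewrite -eq0.
Qed.
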